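(* Assume (a) $G_C=G$ does not depend on $C$; (b) $\mathbf X$ is finite and $\mathsf P_G(X_t=x)>0$ for all $x$; (c) $0<I(\theta,\vartheta\mid x)<\infty$ for all $\theta\ne\vartheta$ and all $x$; (d) $\Theta$ is finite; (e) (saddle point) for every configuration $(\theta_1,\theta_2)$ that is not implicitly revealing and has arm 2 preferred for every $x$, $$\inf_{\{\theta:\exists x_0,\ \mu_\theta(x_0)>\mu_{\theta_2}(x_0)\}}\sup_x I(\theta_1,\theta\mid x)=\sup_x\inf_{\{\theta:\exists x_0,\ \mu_\theta(x_0)>\mu_{\theta_2}(x_0)\}} I(\theta_1,\theta\mid x),$$ and symmetrically when arm 1 is preferred for every $x$. Then there exists an allocation rule $\{\phi_\tau\}$ such that: (1) for every implicitly revealing $C_0$, $\lim_{t\to\infty}\mathsf E_{C_0}\{T_{inf}(t)\}<\infty$; (2) for every $C_0=(\theta_1,\theta_2)$ that is not implicitly revealing (and has distinct arms), $\limsup_{t\to\infty}\mathsf E_{C_0}\{T_{inf}(t)\}/\log t\le 1/K_{C_0}$, where, if arm 2 is preferred for every $x$, $K_{C_0}=\inf_{\{\theta:\exists x_0,\ \mu_\theta(x_0)>\mu_{\theta_2}(x_0)\}}\sup_x I(\theta_1,\theta\mid x)$, and symmetrically if arm 1 is preferred.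
   Context: Two-armed bandit with side observations. $\Theta\subset\mathbb R$ is a parameter set and $\mathbf X\subset\mathbb R$. Known conditional distributions $\{F_\theta(dy\mid x)\}_{\theta\in\Theta}$ on $\mathbb R$ and a known law $G$ on $\mathbf X$. Under configuration $C_0=(\theta_1,\theta_2)\in\Theta^2$, $X_1,X_2,\dots$ are i.i.d. with law $G$, and for each arm $i$ the pairs $(X_t,Y^i_t)$ are i.i.d. with joint law $G(dx)F_{\theta_i}(dy\mid x)$. An allocation rule is $\phi_t\in\{1,2\}$ depending only on $X_1,\dots,X_t$ and previously observed rewards $Y^{\phi_\tau}_\tau$, $\tau<t$. $\mu_\theta(x)=\int yF_\theta(dy\mid x)$ (finite); $M_C(x)=\arg\max_i\mu_{i(C)}(x)$ with $1(C)=\theta_1,2(C)=\theta_2$. A configuration $C$ is implicitly revealing if there exist $x_1,x_2\in\mathbf X$ with $M_C(x_1)=1$ and $M_C(x_2)=2$; otherwise the preferred arm $M_C(x)$ is the same for all $x$. $T_{inf}(t)=\sum_{\tau\le t}1\{\phi_\tau\ne M_{C_0}(X_\tau)\}$. $I(\theta,\vartheta\mid x)$ is the Kullback–Leibler number between $F_\theta(\cdot\mid x)$ and $F_\vartheta(\cdot\mid x)$. Conventions: $\inf\emptyset=\infty$, $1/\infty=0$. *)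

(* Defs.v *)
From HB Require Import structures.
From mathcomp Require Import all_boot all_order all_algebra.
From mathcomp Require Import all_classical all_reals all_analysis.

Set Implicit Arguments.
Unset Strict Implicit.
Unset Printing Implicit Defensive.

Import Order.TTheory GRing.Theory Num.Theory.
Local Open Scope classical_set_scope.
Local Open Scope ring_scope.

Inductive arm := arm1 | arm2.

Definition other (a : arm) : arm := match a with arm1 => arm2 | arm2 => arm1 end.

Section bandit.
Variables (R : realType) (Theta X : finType).

Definition config := (Theta * Theta)%type.

Definition param (C : config) (a : arm) : Theta :=
  match a with arm1 => C.1 | arm2 => C.2 end.

Variable F : Theta -> X -> probability R R.

Definition mean (th : Theta) (x : X) : R := fine (\int[F th x]_y (y%:E))%E.

Definition KLdiv (P Q : probability R R) : \bar R :=
  if pselect (P `<< Q) then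
    (\int[P]_y (ln (fine (Radon_Nikodym (charge_of_finite_measure P) Q y)))%:E)%E
  else +oo%E.

Definition KL (th vth : Theta) (x : X) : \bar R := KLdiv (F th x) (F vth x).

Definition preferred (C : config) (x : X) (a : arm) : Prop :=
  mean (param C (other a)) x <= mean (param C a) x.

Definition implicitly_revealing (C : config) : Prop :=
  (exists x1, preferred C x1 arm1) /\ (exists x2, preferred C x2 arm2).

Definition K_infsup (th th' : Theta) : \bar R :=
  ereal_inf [set ereal_sup [set KL th vth x | x in [set: X]]
            | vth in [set vth | exists x0, mean th' x0 < mean vth x0]].

Definition K_supinf (th th' : Theta) : \bar R :=
  ereal_sup [set ereal_inf [set KL th vth x
                           | vth in [set vth | exists x0, mean th' x0 < mean vth x0]]
            | x in [set: X]].

(* Allocation rules: phi_t (t = 0,1,2,... standing for the paper's t+1)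
   depends on X_1..X_{t+1} and on the previously observed rewards. *)
Definition alloc_rule := forall t : nat, t.+1.-tuple X -> t.-tuple R -> arm.

Definition measurable_rule (phi : alloc_rule) : Prop :=
  forall (t : nat) (xs : t.+1.-tuple X),
    measurable [set ys : t.-tuple R | phi t xs ys = arm1].

(* G : law of X_t, given by its probability mass function. *)
Variable G : X -> R.

Definition inferior_cost (C : config) (x : X) (a : arm) : R :=
  if `[< preferred C x a >] then 0 else 1.

(* Expected number of inferior pulls during the next n steps, from a
   history of length k (observed side informations xs, observed rewards ys).
   The history is generated sequentially: X ~ G, then the observed reward
   Y ~ F_{theta_{phi}}(. | X) (Ionescu-Tulcea). *)
Fixpoint cost_to_go (phi : alloc_rule) (C : config) (n k : nat)
    (xs : k.-tuple X) (ys : k.-tuple R) {struct n} : \bar R :=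
  match n with
  | 0 => 0%E
  | n'.+1 =>
    (\sum_(x : X) (G x)%:E *
       ((inferior_cost C x (phi k [tuple of rcons xs x] ys))%:E +
        \int[F (param C (phi k [tuple of rcons xs x] ys)) x]_y
           cost_to_go phi C n' [tuple of rcons xs x] [tuple of rcons ys y]))%E
  end.

Definition expected_Tinf (phi : alloc_rule) (C : config) (t : nat) : \bar R :=
  cost_to_go phi C t [tuple] [tuple].

End bandit.

Definition einv (R : realType) (K : \bar R) : \bar R :=
  match K with
  | EFin r => (r^-1)%:E
  | _ => 0%E
  end.

(* Main.v *)
Require Import Defs.
From HB Require Import structures.
From mathcomp Require Import all_boot all_order all_algebra.
From mathcomp Require Import all_classical all_reals all_analysis.
From mathcomp Require Import measurable_realfun ring lra zify.

Set Implicit Arguments.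
Unset Strict Implicit.
Unset Printing Implicit Defensive.

Import Order.TTheory GRing.Theory Num.Theory.
Import numFieldNormedType.Exports.
Local Open Scope classical_set_scope.
Local Open Scope ring_scope.

(** Each arm is estimated by maximum likelihood.  The rule pulls the arm that
    looks better at the current side observation, except in two situations
    where it pulls the arm not pulled last: when the estimated means are tied,
    and when one arm looks better everywhere, some parameter that would make
    the other arm better somewhere has log-likelihood less than
    [ln t + 2 ln ln t] (up to shifts) below the maximum, and the side
    observation is the saddle point at which the other arm is most
    informative.

    The expected cost is bounded by potential functions.  Under the true
    parameter, the likelihood ratio of a wrong parameter raised to a small power
    [s] shrinks in mean by the factor [1 - s (KL - delta)] at each pull.
    - Wrong estimates: the sum over wrong parameters of these powers is at least
      one while an arm is misestimated.  A misestimated arm is pulled, or was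
      just pulled and is being alternated, with probability bounded below,
      unless exploration has stopped; so all but the last case cost a bounded
      amount in expectation.
    - Exploration stopped by mistake: the likelihood ratio itself has mean at
      most one, so at time [t] this has probability at most
      [1 / (t (ln t)^2)], which is summable.
    - Correct estimates: a cost occurs only during exploration, and the same
      powers show that about [ln t / K] explorations suffice.

    Potentials are evaluated along the backward recursion defining the expected
    cost, so no probability space of trajectories is needed. *)

(** * Exponential moments *)

Section mean_le.
Context d (T : measurableType d) (R : realType) (P : probability T R).
Implicit Types (f g : T -> R) (b c k : R).

(** Measurability and nonnegativity are bundled with the bound because additivity and homogeneity of
    the integral require them. *)
Definition mean_le f c : Prop :=
  [/\ measurable_fun setT f, forall y, 0 <= f y &
      (\int[P]_y (f y)%:E <= c%:E)%E].

Lemma mean_le_cst c : 0 <= c -> mean_le (fun=> c) c.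
Proof.
move=> c0; split => //.
by rewrite (integral_cst P measurableT c%:E)/= probability_setT mule1.
Qed.

Lemma mean_leW f b c : b <= c -> mean_le f b -> mean_le f c.
Proof.
by move=> bc [mf f0 fb]; split => //; rewrite (le_trans fb)// lee_fin.
Qed.

Lemma mean_leD f g b c : mean_le f b -> mean_le g c ->
  mean_le (fun y => f y + g y) (b + c).
Proof.
move=> [mf f0 fb] [mg g0 gc]; split.
- exact: measurable_funD.
- by move=> y; rewrite addr_ge0.
- under eq_integral do rewrite EFinD.
  rewrite ge0_integralD//=; [|by move=> *; rewrite lee_fin| |
    by move=> *; rewrite lee_fin|]; [|exact/measurable_EFinP..].
  by rewrite EFinD leeD.
Qed.

Lemma mean_leZ k f b : 0 <= k -> mean_le f b ->
  mean_le (fun y => k * f y) (k * b).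
Proof.
move=> k0 [mf f0 fb]; split.
- exact: measurable_funM.
- by move=> y; rewrite mulr_ge0.
- under eq_integral do rewrite EFinM.
  rewrite ge0_integralZl//=; last by move=> *; rewrite lee_fin.
    by rewrite EFinM lee_wpmul2l// lee_fin.
  exact/measurable_EFinP.
Qed.

Lemma mean_le_sum (I : Type) (r : seq I) (p : pred I) (f : I -> T -> R)
    (c : I -> R) :
  (forall i, p i -> mean_le (f i) (c i)) ->
  mean_le (fun y => \sum_(i <- r | p i) f i y) (\sum_(i <- r | p i) c i).
Proof.
move=> fc; elim: r => [|i r IH].
  rewrite big_nil; under eq_fun do rewrite big_nil.
  exact: mean_le_cst.
rewrite big_cons; under eq_fun do rewrite big_cons.
by case: ifPn => // pi; apply: mean_leD => //; exact: fc.
Qed.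

Lemma mean_le_dom f g c :
  measurable_fun setT f -> (forall y, 0 <= f y <= g y) -> mean_le g c -> mean_le f c.
Proof.
move=> mf fg [mg g0 gc]; split => //; first by move=> y; case/andP: (fg y).
apply: le_trans gc; apply: ge0_le_integral => //=.
- by move=> y _; rewrite lee_fin; case/andP: (fg y).
- exact/measurable_EFinP.
- exact/measurable_EFinP.
- by move=> y _; rewrite lee_fin; case/andP: (fg y).
Qed.

End mean_le.

(* Integrals of nonnegative functions are suprema over simple functions, so
   monotonicity does not require measurability. *)
Lemma ge0_le_integral_nomeas d (T : measurableType d) (R : realType)
    (mu : {measure set T -> \bar R}) (f g : T -> \bar R) :
  (forall x, 0 <= f x)%E -> (forall x, f x <= g x)%E ->
  (\int[mu]_x f x <= \int[mu]_x g x)%E.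
Proof.
move=> f0 fg.
have g0 x : (0 <= g x)%E by exact: le_trans (f0 x) (fg x).
rewrite !ge0_integralTE//; apply: le_ereal_sup => _ [h hf <-].
by exists h => // x; exact: le_trans (hf x) (fg x).
Qed.

Section exp_moments.
Context {R : realType}.

(** Convexity of the exponential between [0] and [z]: the tangent at [s * z] lies below it at both
    ends, and the two tangent values are averaged with weights [1 - s] and [s]. *)
Lemma expR_young (s z : R) : 0 <= s <= 1 ->
  expR (s * z) <= 1 - s + s * expR z.
Proof.
move=> /andP[s0 s1]; set w := s * z.
have h1 : expR w * (1 - w) <= 1.
  by rewrite -ler_pdivlMl ?expR_gt0// mulr1 -expRN expR_ge1Dx.
have h2 : expR w * (1 + (z - w)) <= expR z.
  by rewrite -ler_pdivlMl ?expR_gt0// -expRN -expRD [- w + z]addrC expR_ge1Dx.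
have e : expR w = (1 - s) * (expR w * (1 - w)) + s * (expR w * (1 + (z - w))).
  by rewrite /w; ring.
rewrite [leLHS]e lerD//; last exact: ler_wpM2l.
by rewrite -[leRHS]mulr1 ler_wpM2l// subr_ge0.
Qed.

(** A difference quotient at [0]. With [u = z / (n+1)], the inequality [1 + t <= exp t] used twice
    gives [u exp(-u) <= 1 - exp(-u) <= u] for either sign of [z]. *)
Lemma cvg_expR_slope (z : R) :
  (fun n => n.+1%:R * (1 - expR (- (n.+1%:R^-1 * z)))) @ \oo --> z.
Proof.
apply: (@squeeze_cvgr _ _ _ _ (fun n => z * expR (- (n.+1%:R^-1 * z)))
  (fun=> z)).
- apply: nearW => n /=; set u := n.+1%:R^-1 * z.
  have zE : z = n.+1%:R * u by rewrite /u mulrA divff ?mul1r// pnatr_eq0.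
  rewrite [X in X * _ <= _]zE [X in _ <= _ <= X]zE -mulrA; apply/andP.
  split; apply: ler_wpM2l => //.
    rewrite -ler_pdivlMr ?expR_gt0// -expRN opprK mulrBl mul1r -expRD addNr.
    by rewrite expR0 lerBrDr addrC expR_ge1Dx.
  by rewrite lerBlDl -lerBlDr expR_ge1Dx.
- rewrite -[X in _ --> X]mulr1; apply: cvgMl_tmp.
  have h : (fun n => - (n.+1%:R^-1 * z) : R) @ \oo --> - (0 * z).
    by apply: cvgN; apply: cvgMr_tmp; exact: cvg_harmonic.
  rewrite mul0r oppr0 in h.
  have h2 : (fun n => expR (- (n.+1%:R^-1 * z)) : R) @ \oo --> expR 0.
    by apply: continuous_cvg h; exact: continuous_expR.
  by rewrite expR0 in h2.
- exact: cvg_cst.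
Qed.

Context d (T : measurableType d) (P : probability T R) (Z : T -> R) (m : R).
Hypothesis mZ : measurable_fun setT Z.
Hypothesis iZ : P.-integrable setT (EFin \o Z).
Hypothesis EZ : (\int[P]_y (Z y)%:E = m%:E)%E.
Hypothesis E1 : mean_le P (fun y => expR (- Z y)) 1.

Lemma mean_le_expR_shrink r s c : 0 <= r <= 1 ->
  mean_le P (fun y => expR (- (s * Z y))) c ->
  mean_le P (fun y => expR (- (r * s * Z y))) (1 - r + r * c).
Proof.
move=> r01 sc; have [[r0 r1] [mf f0 _]] := (andP r01, sc).
apply: (@mean_le_dom _ _ _ _ _ (fun y => (1 - r) + r * expR (- (s * Z y)))).
- apply: measurableT_comp => //; apply: measurableT_comp => //.
  exact: measurable_funM.
- by move=> y; rewrite expR_ge0/= -mulrA -mulrN expR_young.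
- by apply: mean_leD; [apply: mean_le_cst; rewrite subr_ge0|exact: mean_leZ].
Qed.

Lemma mean_le_expR_frac s : 0 <= s <= 1 ->
  mean_le P (fun y => expR (- (s * Z y))) 1.
Proof.
move=> s01; have := @mean_le_expR_shrink s 1 1 s01.
rewrite mulr1 subrK; apply.
by under eq_fun do rewrite mul1r.
Qed.

(** The mean of [exp(-sZ)] has slope [-m] at [s = 0], by dominated convergence along [s = 1/(n+1)].
    This yields the bound at one exponent [s0], and convexity carries it to all smaller ones. *)
Lemma mean_le_expR_rate delta : 0 < delta ->
  exists2 s0 : R, 0 < s0 <= 1 & forall s, 0 < s <= s0 ->
    mean_le P (fun y => expR (- (s * Z y))) (1 - s * (m - delta)).
Proof.
move=> d0.
pose g n y := n.+1%:R * (1 - expR (- (n.+1%:R^-1 * Z y))).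
have mg n : measurable_fun setT (g n).
  apply: measurable_funM => //; apply: measurable_funB => //.
  apply: measurableT_comp => //; apply: measurableT_comp => //.
  exact: measurable_funM.
have s01 n : 0 <= (n.+1%:R^-1 : R) <= 1.
  by rewrite invr_ge0 ler0n/= invf_le1 ?ltr0n// ler1n.
have iexp s : 0 <= s <= 1 ->
    P.-integrable setT (EFin \o (fun y => expR (- (s * Z y)))).
  move=> s'01; have [mf f0 fc] := mean_le_expR_frac s'01.
  apply/integrableP; split; first exact/measurable_EFinP.
  under eq_integral do rewrite gee0_abs ?lee_fin//.
  exact: le_lt_trans fc (ltry _).
have [|||||_ _] := @dominated_convergence _ _ _ P setT measurableT
  (fun n => EFin \o g n) (EFin \o Z) (fun y => (`|Z y| + expR (- Z y))%:E)
  _ _ _ _ _.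
- by move=> n; exact/measurable_EFinP.
- exact/measurable_EFinP.
- by apply: aeW => y _; apply: cvg_EFin; [exact: nearW|exact: cvg_expR_slope].
- have i1 : P.-integrable setT (EFin \o (fun y => expR (- (1 * Z y)))).
    by apply: iexp; rewrite ler01 lexx.
  have := integrableD measurableT (integrable_abse iZ) i1.
  by apply: eq_integrable => // y _; rewrite /= mul1r.
(* Domination: [g n] lies between [1 - exp(-Z)], by convexity, and [Z]. *)
- apply: aeW => y n _ /=; rewrite lee_fin /g.
  have n0 : 0 <= n.+1%:R :> R by [].
  have nV : n.+1%:R * n.+1%:R^-1 = 1 :> R by rewrite divff.
  rewrite ler_norml; apply/andP; split.
    have := expR_young (- Z y) (s01 n).
    rewrite -(ler_pM2l (_ : 0 < n.+1%:R :> R))// mulrN.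
    rewrite mulrDr mulrBr mulrA nV mul1r mulr1 mulrBr mulr1.
    by have := normr_ge0 (Z y); lra.
  apply: (@le_trans _ _ (Z y)); last first.
    by have := ler_norm (Z y); have := expR_ge0 (- Z y); lra.
  have zE : Z y = n.+1%:R * (n.+1%:R^-1 * Z y) by rewrite mulrA nV mul1r.
  rewrite [leRHS]zE ler_wpM2l//.
  by rewrite lerBlDl -lerBlDr expR_ge1Dx.
rewrite [X in _ --> X]EZ => dc.
have : \forall n \near \oo, ((m - delta)%:E <= \int[P]_y (g n y)%:E)%E.
  case/fine_cvgP: dc => fin /cvgr_ge /(_ _ (_ : m - delta < m)) h.
  near=> n; have fn : (\int[P]_y (g n y)%:E)%E \is a fin_num by near: n.
  rewrite -(fineK fn) lee_fin; near: n; apply: h.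
  by rewrite ltrBlDr ltrDl.
move=> [n _ /(_ n (leqnn n)) /= hn].
set s0 : R := n.+1%:R^-1.
have s00 : 0 < s0 by rewrite invr_gt0.
exists s0; first by rewrite s00; case/andP: (s01 n).
have key : mean_le P (fun y => expR (- (s0 * Z y))) (1 - s0 * (m - delta)).
  have [mf f0 _] := mean_le_expR_frac (s01 n); split => //.
  have ig : P.-integrable setT (EFin \o (fun y => 1 - expR (- (s0 * Z y)))).
    rewrite (_ : _ \o _ = (fun y => 1%:E - (expR (- (s0 * Z y)))%:E)%E)//.
    apply: integrableB => //; first exact: finite_measure_integrable_cst.
    exact: iexp (s01 n).
  have e1 : (\int[P]_y (expR (- (s0 * Z y)))%:E =
      1 - \int[P]_y (1 - expR (- (s0 * Z y)))%:E)%E.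
    have -> : (fun y => (expR (- (s0 * Z y)))%:E) =
        (fun y => 1%:E - (1 - expR (- (s0 * Z y)))%:E)%E.
      by apply/funext => y; rewrite -EFinB; congr _%:E; ring.
    rewrite integralB//; last exact: finite_measure_integrable_cst.
    by rewrite (integral_cst P measurableT 1%:E)/= probability_setT mule1.
  have e2 : (\int[P]_y (g n y)%:E =
      n.+1%:R%:E * \int[P]_y (1 - expR (- (s0 * Z y)))%:E)%E.
    by rewrite -integralZl.
  have f2 := integrable_fin_num measurableT ig.
  rewrite e1 -(fineK f2) -EFinB lee_fin lerB//.
  move: hn; rewrite e2 -(fineK f2) -EFinM lee_fin.
  by rewrite -ler_pdivrMl// -ler_pdivlMr// invrK mulrC.
(* The target is linear in [s], so it is the chord between the values at [0] and at [s0]. *)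
move=> s /andP[sp ss0].
have -> : s = (s / s0) * s0 by rewrite divfK// gt_eqF.
set r := s / s0.
have -> : 1 - r * s0 * (m - delta) = 1 - r + r * (1 - s0 * (m - delta)) by ring.
apply: mean_le_expR_shrink => //.
by rewrite /r ler_pdivrMr// mul1r ss0 andbT divr_ge0// ltW.
Unshelve. all: by end_near. Qed.
End exp_moments.

(** * Log-likelihoods *)

Lemma null_dominates_ae d (T : measurableType d) (R : realType)
    (nu mu : {measure set T -> \bar R}) (Q : T -> Prop) : nu `<< mu ->
  (\forall y \ae mu, Q y) -> \forall y \ae nu, Q y.
Proof.
move=> /null_content_dominatesP m21 [A [*]]; exists A; split => //.
exact: m21.
Qed.

Section log_likelihood.
Context (R : realType) (J : Type) (P : J -> probability R R) (i0 : J).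
Hypothesis KLP : forall i j, i <> j ->
  (0 < KLdiv (P i) (P j))%E /\ (KLdiv (P i) (P j) < +oo)%E.

(** Finite divergences make all [P i] mutually absolutely continuous, so [P i0] can serve as common
    reference measure. *)
Let RN i : R -> \bar R := Radon_Nikodym_SigmaFinite.f (P i) (P i0).

(* The value [1] on the null set where the density vanishes keeps [q]
   positive everywhere. *)
Let q i y : R := if 0 < fine (RN i y) then fine (RN i y) else 1.

Let dom i j : P i `<< P j.
Proof.
have [->//|ij] := pselect (i = j).
by have [_] := KLP ij; rewrite /KLdiv; case: pselect.
Qed.

Arguments dom : clear implicits.

Let RN_ge0 i y : (0 <= RN i y)%E.
Proof. apply: Radon_Nikodym_SigmaFinite.f_ge0; exact: dom. Qed.

Let RN_fin i y : RN i y \is a fin_num.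
Proof. apply: Radon_Nikodym_SigmaFinite.f_fin_num; exact: dom. Qed.

Let mRN i : measurable_fun setT (RN i).
Proof.
apply: (@measurable_int _ _ _ (P i0)).
apply: Radon_Nikodym_SigmaFinite.f_integrable; exact: dom.
Qed.

Let q_gt0 i y : 0 < q i y.
Proof. by rewrite /q; case: ifP. Qed.

Let mq i : measurable_fun setT (q i).
Proof.
have mf : measurable_fun setT (fun y => fine (RN i y)).
  exact: measurableT_comp.
apply: measurable_fun_ifT => //; exact: measurable_fun_ltr.
Qed.

Let RN_gt0_ae i j : \forall y \ae P i, 0 < fine (RN j y).
Proof.
apply: (null_dominates_ae (dom i j)).
have mA : measurable (RN j @^-1` [set 0%E]).
  by rewrite -[X in measurable X]setTI; exact: mRN.
exists (RN j @^-1` [set 0%E]); split => //.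
- transitivity (\int[P i0]_(y in RN j @^-1` [set 0%E]) RN j y)%E.
    by apply: Radon_Nikodym_SigmaFinite.f_integral => //; exact: dom.
  by apply: integral0_eq => y.
- move=> y /= h; apply: contrapT => y0; apply: h.
  rewrite fine_gt0//; rewrite lt0e RN_ge0 andbT.
  by rewrite ltey_eq RN_fin /= andbT; apply/eqP.
Qed.

Let q_ae i j : ae_eq (P i) setT (EFin \o q j) (RN j).
Proof.
have := RN_gt0_ae i j; apply: filterS => y h _.
by rewrite /= /q h fineK.
Qed.

Definition loglik i y : R := ln (q i y).

Lemma measurable_loglik i : measurable_fun setT (loglik i).
Proof. by apply: measurableT_comp => //; exact: measurable_ln. Qed.

(** After a change of measure to [P i0] the integrand is [q j / q i] times the density of [P i],
    hence at most [q j], which integrates to one. It is zero where the density of [P i] vanishes. *)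
Lemma mean_le_loglik i j :
  mean_le (P i) (fun y => expR (loglik j y - loglik i y)) 1.
Proof.
split=> [|y|]; first last.
- have := @Radon_Nikodym_SigmaFinite.change_of_variables _ _ _ (P i) (P i0)
    (dom i i0)
    (fun y => (expR (loglik j y - loglik i y))%:E) setT.
  move=> <-//; last first.
    apply/measurable_EFinP; apply: measurableT_comp => //.
    by apply: measurable_funB; exact: measurable_loglik.
  apply: (@le_trans _ _ (\int[P i0]_y (q j y)%:E)%E).
    apply: ge0_le_integral_nomeas => y.
      by rewrite mule_ge0 ?lee_fin ?expR_ge0//; exact: RN_ge0.
    rewrite -[Radon_Nikodym_SigmaFinite.f _ _ _]/(RN i y) -(fineK (RN_fin i y)).
    rewrite -EFinM lee_fin expRB /loglik !lnK ?posrE ?q_gt0//.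
    rewrite [q i y]/q; case: ltP => [ri|ri]; first by rewrite divfK// gt_eqF.
    have -> : fine (RN i y) = 0.
      by apply/eqP; rewrite eq_le ri/= fine_ge0.
    by rewrite mulr0 ltW.
  rewrite (ae_eq_integral (RN j)) //; last 2 first.
  + exact/measurable_EFinP.
  + exact: q_ae.
  have := @Radon_Nikodym_SigmaFinite.f_integral _ _ _ (P j) (P i0)
    (dom j i0) setT measurableT.
  by rewrite [X in X = _ -> _](@probability_setT _ _ _ (P j)) => <-.
- exact: expR_ge0.
- apply: measurableT_comp => //.
  by apply: measurable_funB; exact: measurable_loglik.
Qed.

(** The chain rule makes the derivative of [P i] with respect to [P j] the quotient of the two
    densities, almost everywhere for [P i]. *)
Lemma loglik_KLdiv i j : i <> j ->
  (P i).-integrable setT (EFin \o (fun y => loglik i y - loglik j y)) /\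
  (\int[P i]_y (loglik i y - loglik j y)%:E = KLdiv (P i) (P j))%E.
Proof.
move=> ij; have [K0 Koo] := KLP ij.
have KE : (\int[P i]_y (loglik i y - loglik j y)%:E = KLdiv (P i) (P j))%E.
  rewrite /KLdiv; case: pselect => [Pij|/(_ (dom i j))//].
  apply: ae_eq_integral => //.
  - by apply/measurable_EFinP; apply: measurable_funB; exact: measurable_loglik.
  - apply/measurable_EFinP; apply: measurableT_comp; first exact: measurable_ln.
    have mr : measurable_fun setT
        (Radon_Nikodym (charge_of_finite_measure (P i)) (P j)).
      apply: (@measurable_int _ _ _ (P j)); apply: Radon_Nikodym_integrable.
      exact: Pij.
    exact: measurableT_comp mr.
  have c := @Radon_Nikodym_SigmaFinite.chain_rule _ _ _ (P i) (P i0) (P j) _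
    (dom i j) (dom j i0) measurableT.
  have {}c := null_dominates_ae (dom i i0) c.
  have r := null_dominates_ae (dom i j)
    (@ae_eq_Radon_Nikodym_SigmaFinite _ _ _ (P i) (P j) (dom i j) _
      measurableT).
  have FF : Filter (nbhs (almost_everywhere (P i))).
    exact: ae_filter_ringOfSetsType.
  have := @filterI _ _ FF _ _ (@filterI _ _ FF _ _ c r)
    (@filterI _ _ FF _ _ (RN_gt0_ae i i) (RN_gt0_ae i j)).
  apply: filterS => y [[cy ry] [yi yj]] _; rewrite -(ry I).
  have {cy} := cy I; rewrite -!/(RN _ _).
  set f := Radon_Nikodym_SigmaFinite.f _ _ _ => cy.
  have ff : f \is a fin_num.
    by apply: Radon_Nikodym_SigmaFinite.f_fin_num; exact: dom.
  congr _%:E; rewrite /loglik /q yi yj.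
  have -> : fine f = fine (RN i y) / fine (RN j y).
    by rewrite cy fineM// mulfK// gt_eqF.
  by rewrite ln_div.
split => //; apply/integrableP; split.
  by apply/measurable_EFinP; apply: measurable_funB; exact: measurable_loglik.
(* Since [+oo - +oo] is [-oo], positivity of the divergence excludes an infinite negative part; its
   finiteness then excludes an infinite positive part. *)
move: KE K0 Koo => <-; rewrite integralE.
set f := (fun y => _%:E).
have mf : measurable_fun setT f.
  by apply/measurable_EFinP; apply: measurable_funB; exact: measurable_loglik.
have -> : (\int[P i]_y `|f y| = \int[P i]_y (f^\+ y) + \int[P i]_y (f^\- y))%E.
  rewrite -ge0_integralD//.
  - by apply: eq_integral => y _; exact: (congr1 (@^~ y) (fune_abse f)).
  - exact: measurable_funepos.
  - exact: measurable_funeneg.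
have : (0 <= \int[P i]_y (f^\+ y))%E by apply: integral_ge0.
have : (0 <= \int[P i]_y (f^\- y))%E by apply: integral_ge0.
case: (integral _ _ _) => [a| |]; case: (integral _ _ _) => [b| |] //= _ _ _ _.
by rewrite -EFinD ltry.
Qed.
End log_likelihood.

(** * The allocation rule *)

Definition is_arm1 (a : arm) : bool := if a is arm1 then true else false.
Definition arm_of_bool (b : bool) : arm := if b then arm1 else arm2.
Lemma is_arm1K : cancel is_arm1 arm_of_bool. Proof. by case. Qed.

HB.instance Definition _ := Finite.copy arm (can_type is_arm1K).

Lemma otherK : involutive other. Proof. by case. Qed.

Lemma neq_other (a b : arm) : a != b -> a = other b.
Proof. by case: a; case: b. Qed.

Lemma other_neq (a : arm) : (other a == a) = false.
Proof. by case: a. Qed.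

Section rule.
Variables (R : realType) (Theta X : finType).
Variables (F : Theta -> X -> probability R R) (G : X -> R).
Variables (L : Theta -> X -> R -> R) (gam : nat -> R).
Variables (xstar : Theta -> Theta -> X) (th0 : Theta).

Local Notation mu := (mean F).

(** The statistics through which the history acts; [npull] serves the analysis, where it counts
    explorations. *)
Record state := State {
  ll : arm -> Theta -> R;
  lastp : arm;
  npull : arm -> X -> nat }.

Definition state0 := State (fun _ _ => 0) arm1 (fun _ _ => 0%N).

Definition update (s : state) (x : X) (a : arm) (y : R) : state :=
  State (fun b th => if b == a then ll s b th + L th x y else ll s b th)
        a
        (fun b z => if (b == a) && (z == x) then (npull s b z).+1
                    else npull s b z).

Definition alt (th v : Theta) : bool := [exists x0, mu th x0 < mu v x0].

Definition best (C : config Theta) (a : arm) : bool :=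
  [forall x, mu (param C (other a)) x < mu (param C a) x].

(* The decision depends on the state only through finitely many bits:
   [cmp a v th] and [thr a v th] compare the log-likelihoods of [v] and [th] on
   arm [a] with each other and with the exploration threshold. *)
Section decision.
Variables (cmp thr : arm -> Theta -> Theta -> bool) (l : arm) (x : X).

Definition estimate_of (a : arm) : Theta :=
  odflt th0 [pick th | [forall v, cmp a v th]].

Let C : config Theta := (estimate_of arm1, estimate_of arm2).

Definition explore_of (a : arm) : bool :=
  [exists v, alt (param C a) v && thr (other a) (param C (other a)) v].

Definition alternate_of : bool :=
  (mu C.1 x == mu C.2 x) ||
  [exists a, [&& best C a, explore_of a &
                 x == xstar (param C (other a)) (param C a)]].

Definition decide_of : arm :=
  if alternate_of then other l
  else if mu C.2 x < mu C.1 x then arm1 else arm2.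

End decision.

Definition le_ll s a v th := ll s a v <= ll s a th.
Definition lt_gam t s a v th := ll s a v - ll s a th < gam t.
Definition decide t s x := decide_of (le_ll s) (lt_gam t s) (lastp s) x.

Definition hist (xs : seq X) (ys : seq R) : nat * state :=
  foldl (fun p xy => (p.1.+1, update p.2 xy.1 (decide p.1 p.2 xy.1) xy.2))
        (0%N, state0) (zip xs ys).

(** The [zip] in [hist] drops the newest side observation, which has no reward yet and enters only
    through the current decision. *)
Definition rule : alloc_rule R X :=
  fun t xs ys => decide t (hist xs ys).2 (tnth xs ord_max).

Lemma hist_rcons xs ys x y : size xs = size ys ->
  hist (rcons xs x) (rcons ys y) =
  ((hist xs ys).1.+1,
   update (hist xs ys).2 x (decide (hist xs ys).1 (hist xs ys).2 x) y).
Proof. by move=> e; rewrite /hist zip_rcons// foldl_rcons. Qed.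

Lemma hist_rconsl xs ys x : size xs = size ys ->
  hist (rcons xs x) ys = hist xs ys.
Proof.
by move=> e; rewrite /hist -cats1 -[ys in LHS]cats0 zip_cat//= cats0.
Qed.

Lemma hist1 xs ys : size xs = size ys -> (hist xs ys).1 = size xs.
Proof.
elim/last_ind: xs ys => [|xs x IH] ys; first by case: ys.
case/lastP: ys => [|ys y]; rewrite ?size_rcons// => -[e].
by rewrite hist_rcons//= IH.
Qed.

Variable C : config Theta.

Fixpoint value (n k : nat) (s : state) : \bar R :=
  if n is n'.+1 then
    (\sum_(x : X) (G x)%:E *
       ((inferior_cost F C x (decide k s x))%:E +
        \int[F (param C (decide k s x)) x]_y
           value n' k.+1 (update s x (decide k s x) y)))%E
  else 0%E.

(** The rule sees the past only through the time and the state, so the recursion on histories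
    descends to states. *)
Lemma cost_to_goE n k (xs : k.-tuple X) (ys : k.-tuple R) :
  cost_to_go F G rule C n xs ys = value n k (hist xs ys).2.
Proof.
elim: n k xs ys => [//|n IH] k xs ys /=.
have e : size xs = size ys by rewrite !size_tuple.
apply: eq_bigr => x _.
have -> : rule [tuple of rcons xs x] ys = decide k (hist xs ys).2 x.
  rewrite /rule/= hist_rconsl//; congr decide.
  by rewrite (tnth_nth x)/= nth_rcons size_tuple ltnn eqxx.
congr (_ * (_ + _))%E; apply: eq_integral => y _.
by rewrite IH/= hist_rcons//= hist1// size_tuple.
Qed.

Lemma value_ge0 n k s : (forall x, 0 <= G x) -> (0 <= value n k s)%E.
Proof.
move=> G0; elim: n k s => [//|n IH] k s /=.
apply: sume_ge0 => x _; rewrite mule_ge0 ?lee_fin// adde_ge0//.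
  by rewrite lee_fin /inferior_cost; case: ifP.
by apply: integral_ge0 => y _; exact: IH.
Qed.

Lemma value_nondecreasing k s n : (forall x, 0 <= G x) ->
  (value n k s <= value n.+1 k s)%E.
Proof.
move=> G0; elim: n k s => [|n IH] k s; first exact: value_ge0.
rewrite [leLHS]/= [leRHS]/=; apply: lee_sum => x _.
rewrite lee_wpmul2l ?lee_fin//.
rewrite leeD2l//; apply: ge0_le_integral_nomeas => y; first exact: value_ge0.
exact: IH.
Qed.

(* Verification: a nonnegative potential whose expected decrease pays for the
   expected cost of each step bounds the total expected cost. *)
Lemma value_le (V : nat -> state -> R) (E : nat -> state -> X -> R) T :
  (forall x, 0 <= G x) -> (forall k s, 0 <= V k s) ->
  (forall k s x, (k < T)%N ->
    mean_le (F (param C (decide k s x)) x)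
      (fun y => V k.+1 (update s x (decide k s x) y)) (E k s x)) ->
  (forall k s, (k < T)%N ->
    \sum_x G x * (inferior_cost F C x (decide k s x) + E k s x) <= V k s) ->
  forall n k s, (n + k <= T)%N -> (value n k s <= (V k s)%:E)%E.
Proof.
move=> G0 V0 VE drift; elim=> [|n IH] k s nkT; first by rewrite lee_fin.
have kT : (k < T)%N by apply: leq_trans nkT; rewrite addSn ltnS leq_addl.
rewrite [leLHS]/=; apply: (@le_trans _ _
  (\sum_x G x * (inferior_cost F C x (decide k s x) + E k s x))%:E); last first.
  by rewrite lee_fin drift.
rewrite -sumEFin; apply: lee_sum => x _.
rewrite EFinM lee_wpmul2l ?lee_fin// EFinD leeD2l//.
have [_ _] := VE k s x kT; apply: le_trans.
apply: ge0_le_integral_nomeas => y; first exact: value_ge0.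
by apply: IH; rewrite addnS.
Qed.

End rule.

(** * Measurability of the rule *)

Section finite_measurability.
Context d (T : measurableType d).

Lemma measurable_fiber_comp (B : finType) (f : T -> B) (g : B -> bool) :
  (forall b, measurable [set t | f t = b]) ->
  measurable [set t | g (f t)].
Proof.
move=> mf; have -> : [set t | g (f t)] =
    \bigcup_(b in [set` [set b | g b]%SET]) [set t | f t = b].
  apply/seteqP; split => [t /= gt|t [b /=]].
    by exists (f t); rewrite /= ?inE.
  by rewrite inE => gb ->.
by apply: fin_bigcup_measurable.
Qed.

Lemma measurable_fiber_ffun (K : finType) (f : T -> K -> bool) :
  (forall k, measurable [set t | f t k]) ->
  forall b : {ffun K -> bool}, measurable [set t | [ffun k => f t k] = b].
Proof.
move=> mf b; have -> : [set t | [ffun k => f t k] = b] =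
    \bigcap_(k in [set: K]) [set t | f t k = b k].
  apply/seteqP; split => [t /= <- k _ /=|t h]; first by rewrite ffunE.
  by apply/ffunP => k; rewrite ffunE; exact: h.
apply: fin_bigcap_measurable => // k _.
case: (b k); first exact: mf.
rewrite (_ : [set t | f t k = false] = ~` [set t | f t k]).
  exact: measurableC.
by apply/seteqP; split => t /=; case: (f t k).
Qed.

End finite_measurability.

Section rule_measurable.
Variables (R : realType) (Theta X : finType).
Variables (F : Theta -> X -> probability R R).
Variables (L : Theta -> X -> R -> R) (gam : nat -> R).
Variables (xstar : Theta -> Theta -> X) (th0 : Theta).
Hypothesis mL : forall th x, measurable_fun setT (L th x).

Local Notation decide := (decide F gam xstar th0).
Local Notation decide_of := (decide_of F xstar th0).
Local Notation hist := (hist F L gam xstar th0).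

(** The decision factors through a finite type of bits, whose fibers are cut out by finitely many
    comparisons of measurable functions. *)
Lemma measurable_decide d (T : measurableType d) (s : T -> state R Theta X) t x :
  (forall a th, measurable_fun setT (fun w => ll (s w) a th)) ->
  measurable [set w | lastp (s w) == arm1] ->
  forall b, measurable [set w | decide t (s w) x == b].
Proof.
move=> mll ml b.
pose K := (arm * Theta * Theta)%type.
pose f w : {ffun K -> bool} * {ffun K -> bool} * arm :=
  ([ffun k : K => le_ll (s w) k.1.1 k.1.2 k.2],
   [ffun k : K => lt_gam gam t (s w) k.1.1 k.1.2 k.2], lastp (s w)).
pose g (p : {ffun K -> bool} * {ffun K -> bool} * arm) : bool :=
  decide_of (fun a v th => p.1.1 (a, v, th)) (fun a v th => p.1.2 (a, v, th))
    p.2 x == b.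
have -> : [set w | decide t (s w) x == b] = [set w | g (f w)].
  apply/funext => w /=; rewrite /g.
  rewrite (_ : (fun a v th => (f w).1.1 (a, v, th)) = le_ll (s w)); last first.
    by do 3 apply/funext => ?; rewrite ffunE.
  rewrite (_ : (fun a v th => (f w).1.2 (a, v, th)) = lt_gam gam t (s w))//.
  by do 3 apply/funext => ?; rewrite ffunE.
apply: measurable_fiber_comp => -[[b1 b2] b3].
have -> : [set w | f w = (b1, b2, b3)] =
    [set w | [ffun k : K => le_ll (s w) k.1.1 k.1.2 k.2] = b1] `&`
    [set w | [ffun k : K => lt_gam gam t (s w) k.1.1 k.1.2 k.2] = b2] `&`
    [set w | lastp (s w) = b3].
  apply/seteqP; split => w /=; first by case=> -> -> ->.
  by rewrite /f => -[[-> ->] ->].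
apply: measurableI; first apply: measurableI.
- apply: measurable_fiber_ffun => -[[a v] th] /=.
  have := measurable_fun_ler (mll a v) (mll a th).
  by move=> /(_ measurableT [set true]); rewrite setTI; apply.
- apply: measurable_fiber_ffun => -[[a v] th] /=.
  have mB := measurable_funB (mll a v) (mll a th).
  have := measurable_fun_ltr mB (@measurable_cst _ _ T R setT (gam t)).
  by move=> /(_ measurableT [set true]); rewrite setTI; apply.
- case: b3.
    by rewrite (_ : [set _ | _] = [set w | lastp (s w) == arm1])//;
      apply/seteqP; split => w /= /eqP.
  rewrite (_ : [set _ | _] = ~` [set w | lastp (s w) == arm1]).
    exact: measurableC.
  by apply/seteqP; split => w /=; case: (lastp (s w)).
Qed.

Lemma measurable_rule_rule : measurable_rule (rule F L gam xstar th0).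
Proof.
move=> t xs.
pose st k (ys : t.-tuple R) := (hist (take k xs) (take k ys)).2.
have stS k ys (kt : (k < t)%N) : st k.+1 ys =
    update L (st k ys) (tnth xs (widen_ord (leqnSn t) (Ordinal kt)))
      (decide k (st k ys) (tnth xs (widen_ord (leqnSn t) (Ordinal kt))))
      (tnth ys (Ordinal kt)).
  have x0 : X := tnth xs ord0.
  rewrite /st (take_nth x0) ?size_tuple; last exact: ltnW.
  rewrite (take_nth 0) ?size_tuple//.
  have sk : size (take k xs) = size (take k ys).
    by rewrite !size_takel ?size_tuple// ltnW// ltnW.
  rewrite hist_rcons// hist1//= size_takel ?size_tuple; last first.
    by rewrite ltnW// ltnW.
  by rewrite (tnth_nth 0) (tnth_nth x0).
have key k : (k <= t)%N ->
    (forall a th, measurable_fun setT (fun ys => ll (st k ys) a th)) /\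
    measurable [set ys | lastp (st k ys) == arm1].
  elim: k => [_|k IH kt].
    split => [a th|]; rewrite /st; last first.
      rewrite (_ : [set _ | _] = setT)//.
      by apply/seteqP; split => ys //= _; rewrite !take0.
    by under eq_fun do rewrite !take0; exact: measurable_cst.
  have [mll ml] := IH (ltnW kt).
  set x := tnth xs (widen_ord (leqnSn t) (Ordinal kt)).
  have md := measurable_decide k x mll ml.
  split=> [a th|].
    rewrite (_ : (fun _ => _) = (fun ys => if decide k (st k ys) x == a
        then ll (st k ys) a th + L th x (tnth ys (Ordinal kt))
        else ll (st k ys) a th)).
      apply: measurable_fun_ifT => //.
        apply: (measurable_fun_bool true).
        by rewrite setTI; exact: md.
      apply: measurable_funD => //; apply: measurableT_comp => //.
      exact: measurable_tnth.
    by apply/funext => ys; rewrite stS/= eq_sym.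
  rewrite (_ : [set _ | _] = [set ys | decide k (st k ys) x == arm1])//.
  by apply/funext => ys /=; rewrite stS.
have [mll ml] := key t (leqnn t).
have := measurable_decide t (tnth xs ord_max) mll ml arm1.
rewrite (_ : [set _ | _] = [set ys | rule F L gam xstar th0 xs ys = arm1])//.
apply/funext => ys /=; rewrite /rule; apply/propext.
have -> : (hist xs ys) = hist (take t xs) (take t ys).
  have x0 : X := tnth xs ord0.
  have xsE : rcons (take t xs) (nth x0 xs t) = xs.
    by rewrite -take_nth ?size_tuple// take_oversize ?size_tuple.
  rewrite -{1}xsE hist_rconsl; last by rewrite size_takel !size_tuple.
  by rewrite [take t ys]take_oversize ?size_tuple.
by split => /eqP.
Qed.

End rule_measurable.

(** * Which decisions can be costly *)

Section decision_analysis.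
Variables (R : realType) (Theta X : finType).
Variables (F : Theta -> X -> probability R R) (gam : nat -> R).
Variables (xstar : Theta -> Theta -> X) (th0 : Theta).

Local Notation mu := (mean F).
Local Notation decide := (decide F gam xstar th0).
Local Notation state := (state R Theta X).

Definition est (s : state) (a : arm) : Theta := estimate_of th0 (le_ll s) a.

Lemma est_max s a v : ll s a v <= ll s a (est s a).
Proof.
rewrite /est /estimate_of; case: pickP => [th /forallP|none].
  by move=> /(_ v).
have := arg_maxP (ll s a) (erefl : predT th0).
set m := [arg max_(i > th0) ll s a i]%O => -[i _ im].
by have /forallP := none i; case => w; exact: im.
Qed.

Lemma param_pair (f : arm -> Theta) a : param (f arm1, f arm2) a = f a.
Proof. by case: a. Qed.

Variable C : config Theta.

Lemma inferior_cost_range x a : 0 <= inferior_cost F C x a <= 1.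
Proof. by rewrite /inferior_cost; case: ifP; rewrite lexx ler01. Qed.

Lemma inferior_cost_eq0 x a : mu (param C (other a)) x <= mu (param C a) x ->
  inferior_cost F C x a = 0.
Proof. by move=> h; rewrite /inferior_cost asboolT. Qed.

(** The last case also records why no exploration took place: every alternative is already at least
    [gam k] below the maximum. *)
Variant decide_spec k s x : arm -> Prop :=
| DecideTie of mu (est s arm1) x = mu (est s arm2) x :
    decide_spec k s x (other (lastp s))
| DecideExplore a v of (forall z, mu (est s (other a)) z < mu (est s a) z) &
    x = xstar (est s (other a)) (est s a) &
    alt F (est s a) v &
    ll s (other a) (est s (other a)) - ll s (other a) v < gam k :
    decide_spec k s x (other (lastp s))
| DecidePrefer a of mu (est s (other a)) x < mu (est s a) x &
    (forall v, (forall z, mu (est s (other a)) z < mu (est s a) z) ->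
       x = xstar (est s (other a)) (est s a) -> alt F (est s a) v ->
       gam k <= ll s (other a) (est s (other a)) - ll s (other a) v) :
    decide_spec k s x a.

Lemma decideP k s x : decide_spec k s x (decide k s x).
Proof.
rewrite -[decide k s x]/(decide_of F xstar th0 (le_ll s) (lt_gam gam k s)
  (lastp s) x) /decide_of -!/(est s _).
case: ifPn => [|].
  rewrite /alternate_of -!/(est s _)/=.
  have [e _|_ /=] := eqVneq (mu (est s arm1) x) (mu (est s arm2) x).
    exact: DecideTie.
  move=> /existsP[a /and3P[/forallP ba /existsP[v /andP[av tv]] /eqP xE]].
  move: ba av tv xE; rewrite !param_pair => ba av tv xE.
  exact: (DecideExplore (a := a) (v := v)).
rewrite /alternate_of -!/(est s _) negb_or => /andP[ne /existsPn nex].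
have wrong a v : (forall z, mu (est s (other a)) z < mu (est s a) z) ->
    x = xstar (est s (other a)) (est s a) -> alt F (est s a) v ->
    gam k <= ll s (other a) (est s (other a)) - ll s (other a) v.
  move=> ba xE av; have := nex a; rewrite !param_pair xE eqxx andbT.
  rewrite negb_and => /orP[/forallPn[z]|].
    by rewrite !param_pair ba.
  move=> /existsPn /(_ v); rewrite !param_pair av /= /lt_gam.
  by rewrite -leNgt.
case: ltgtP ne => //= lt _; last by apply: DecidePrefer => // v; exact: wrong.
by apply: DecidePrefer => // v; exact: wrong.
Qed.

(** Under correct estimates a tie is free and so is the preferred arm; only exploring the dominated
    arm costs. *)
Lemma correct_estimate_cost k s x : (forall a, est s a = param C a) ->
  inferior_cost F C x (decide k s x) != 0 ->
  exists a v, [/\ forall z, mu (param C (other a)) z < mu (param C a) z,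
    x = xstar (param C (other a)) (param C a), decide k s x = other a,
    alt F (param C a) v &
    ll s (other a) (param C (other a)) - ll s (other a) v < gam k].
Proof.
move=> eC; case: decideP => [e|a v ba xE av lt|a ba _].
- rewrite inferior_cost_eq0 ?eqxx//; move: e; rewrite !eC.
  by case: (lastp s) => /= ->.
- have [->|/neq_other ->] := eqVneq (lastp s) a; last first.
    rewrite otherK inferior_cost_eq0 ?eqxx// -!eC; exact/ltW/ba.
  by move: ba av lt xE; rewrite !eC => ba av lt xE _; exists a, v.
- by rewrite inferior_cost_eq0 ?eqxx// -!eC ltW.
Qed.

(** Suppose no misestimated arm is pulled at any [x] or was pulled last. Then the other arm [p] was
    pulled last, is well estimated and is pulled everywhere, hence by preference and not by
    alternation. Either the true parameter of [a0] never beats [p], and pulling [p] is free, or it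
    is an alternative that the threshold has wrongly discarded. *)
Lemma wrong_estimate_cost k s a0 : est s a0 <> param C a0 ->
  [\/ exists x a, est s a <> param C a /\ (decide k s x = a \/ lastp s = a),
      forall x, inferior_cost F C x (decide k s x) = 0 |
      exists a (v : Theta), v <> param C a /\
        gam k <= ll s a v - ll s a (param C a)].
Proof.
move=> wq; have [h|none] := pselect (exists x a, est s a <> param C a /\
  (decide k s x = a \/ lastp s = a)); first exact: Or31.
have nd x a : est s a <> param C a -> decide k s x = other a.
  by move=> wa; apply: neq_other; apply/eqP => da; apply: none; exists x, a; auto.
set p := other a0; have qE : other p = a0 by rewrite /p otherK.
pose x0 := xstar th0 th0.
have lp : lastp s = p.
  by apply: neq_other; apply/eqP => la; apply: none; exists x0, a0; auto.
have ep : est s p = param C p.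
  by apply: contrapT => wp; apply: none; exists x0, p; auto.
have pref x : mu (est s a0) x < mu (est s p) x /\
    (forall v, (forall z, mu (est s a0) z < mu (est s p) z) ->
       x = xstar (est s a0) (est s p) -> alt F (est s p) v ->
       gam k <= ll s a0 (est s a0) - ll s a0 v).
  have := nd x _ wq; rewrite -/p; case: decideP => [_|b v _ _ _ _|b bx hb].
  - by rewrite lp => /eqP; rewrite other_neq.
  - by rewrite lp => /eqP; rewrite other_neq.
  - by move=> bp; move: bx hb; rewrite bp qE.
have [a1|na1] := boolP (alt F (param C p) (param C a0)).
  apply: Or33; exists a0, (est s a0); split => //.
  by have [_ ->//] := pref (xstar (est s a0) (est s p));
    [move=> z; have [] := pref z|rewrite ep].
apply: Or32 => x; rewrite (nd x _ wq) -/p inferior_cost_eq0// qE leNgt.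
by apply: contra na1 => lt; apply/existsP; exists x.
Qed.

End decision_analysis.

(** * Potentials *)

Section potential.
Variables (R : realType) (Theta X : finType).
Variables (F : Theta -> X -> probability R R) (G : X -> R).
Variables (L : Theta -> X -> R -> R) (gam : nat -> R).
Variables (xstar : Theta -> Theta -> X) (th0 : Theta).
Variable C : config Theta.

Local Notation decide := (decide F gam xstar th0).
Local Notation state := (state R Theta X).
Local Notation update := (update L).
Local Notation est := (est th0).
Local Notation value := (value F G L gam xstar th0 C).

Definition llr (st : state) a v := ll st a v - ll st a (param C a).

Lemma llr_update st x b y a v : llr (update st x b y) a v =
  llr st a v + (if a == b then L v x y - L (param C a) x y else 0).
Proof. by rewrite /llr /=; case: ifP => _; ring. Qed.

(** Powers of the likelihood ratios against the truth: for [p = 1] their means do not increase, for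
    small [p] they contract at each pull of [a]. *)
Definition lrsum (p : R) (Q : pred Theta) (st : state) a : R :=
  \sum_(v | Q v) expR (p * llr st a v).

Lemma lrsum_ge0 p Q st a : 0 <= lrsum p Q st a.
Proof. by apply: sumr_ge0 => v _; exact: expR_ge0. Qed.

Lemma lrsum_ge p (Q : pred Theta) st a v : Q v ->
  expR (p * llr st a v) <= lrsum p Q st a.
Proof.
move=> Qv; rewrite /lrsum (bigD1 v)//= lerDl.
by apply: sumr_ge0 => *; exact: expR_ge0.
Qed.

Lemma mean_le_lrsum p (Q : pred Theta) st a b x c :
  (forall v, Q v -> mean_le (F (param C a) x)
     (fun y => expR (p * (L v x y - L (param C a) x y))) c) ->
  mean_le (F (param C b) x) (fun y => lrsum p Q (update st x b y) a)
    ((if a == b then c else 1) * lrsum p Q st a).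
Proof.
move=> hc; rewrite /lrsum mulr_sumr; apply: mean_le_sum => v Qv.
under eq_fun do rewrite llr_update mulrDr expRD.
rewrite [X in mean_le _ _ X]mulrC; apply: mean_leZ; first exact: expR_ge0.
have [<-|_] := eqVneq a b; first exact: hc.
by under eq_fun do rewrite mulr0 expR0; exact: mean_le_cst.
Qed.

Variables (s rho g : R) (r : nat -> R).
Hypothesis s_gt0 : 0 < s.
Hypothesis rho_lt1 : rho < 1.
Hypothesis g_gt0 : 0 < g.
Hypothesis gG : forall x, g <= G x.
Hypothesis G1 : \sum_x G x = 1.
Hypothesis r_ge0 : forall k, 0 <= r k.
Hypothesis r_gam : forall k, expR (- gam k) <= r k - r k.+1.
Hypothesis L1 : forall th v x,
  mean_le (F th x) (fun y => expR (L v x y - L th x y)) 1.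
Hypothesis Ls : forall th v x, v != th ->
  mean_le (F th x) (fun y => expR (s * (L v x y - L th x y))) rho.

Let G_ge0 x : 0 <= G x. Proof. exact: le_trans (ltW g_gt0) (gG x). Qed.

Let eta : R := (1 - rho) / 2.
Let eta_gt0 : 0 < eta. Proof. by rewrite /eta divr_gt0// subr_gt0. Qed.

Let wrong a : pred Theta := [pred v | v != param C a].
Let V st a := lrsum s (wrong a) st a.
Let U st a := lrsum 1 (wrong a) st a.

(* The bonus [eta] for the last pulled arm is spent when the rule switches to
   the other arm, so that alternation lowers the potential of both arms. *)
Let Phi st := \sum_(a : arm) V st a * (1 + (lastp st == a)%:R * eta).
Let EPhi st b :=
  \sum_(a : arm) V st a * (if a == b then rho * (1 + eta) else 1).

Let mean_le_Phi st x b :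
  mean_le (F (param C b) x) (fun y => Phi (update st x b y)) (EPhi st b).
Proof.
apply: mean_le_sum => a _ /=.
rewrite (_ : (fun _ => _) =
    (fun y => (1 + (b == a)%:R * eta) * V (update st x b y) a)); last first.
  by apply/funext => y; rewrite mulrC.
apply: mean_leW; last first.
  apply: mean_leZ; last by apply: mean_le_lrsum => v; exact: Ls.
  by rewrite addr_ge0// mulr_ge0// ltW.
rewrite -/(V st a) [b == a]eq_sym le_eqVlt; apply/orP; left; apply/eqP.
by case: eqP => _ /=; ring.
Qed.

(** Since [rho = 1 - 2 eta], a pull brings the factor of an arm to
    [(1 - 2 eta)(1 + eta) <= 1 - eta], while an arm pulled last but not now loses its bonus
    [eta]. *)
Let EPhi_drop st b a : b = a \/ lastp st = a ->
  EPhi st b + eta * V st a <= Phi st.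
Proof.
move=> h; rewrite -lerBrDl /Phi /EPhi -sumrB.
have Ha c : (if (b == c) || (lastp st == c) then eta * V st c else 0) <=
    V st c * (1 + (lastp st == c)%:R * eta) -
    V st c * (if c == b then rho * (1 + eta) else 1).
  have V0 : 0 <= V st c by exact: lrsum_ge0.
  have e2 : rho = 1 - 2 * eta by rewrite /eta; field.
  have e0 := eta_gt0.
  rewrite [c == b]eq_sym -mulrBr mulrC; case: eqP => _; case: eqP => _ /=;
    rewrite ?mulr0//; try (by apply: ler_wpM2l => //; rewrite ?e2; nra); nra.
apply: (@le_trans _ _ (\sum_(c : arm)
    if (b == c) || (lastp st == c) then eta * V st c else 0)).
  rewrite (bigD1 a)//= (_ : (b == a) || (lastp st == a)); last first.
    by case: h => ->; rewrite eqxx ?orbT.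
  rewrite lerDl; apply: sumr_ge0 => c _; case: ifP => // _.
  by rewrite mulr_ge0 ?lrsum_ge0// ltW.
by apply: ler_sum => c _; exact: Ha.
Qed.

Let EPhi_le st b : EPhi st b <= Phi st.
Proof.
apply: le_trans (EPhi_drop (or_introl (erefl b))).
by rewrite lerDl mulr_ge0 ?lrsum_ge0// ltW.
Qed.

Let Usum st := \sum_(a : arm) U st a.
Let Usum_ge0 st : 0 <= Usum st.
Proof. by apply: sumr_ge0 => a _; exact: lrsum_ge0. Qed.

Let c : R := (g * eta)^-1.
Let c_ge0 : 0 <= c. Proof. by rewrite invr_ge0 mulr_ge0// ltW. Qed.

(** The first term pays for wrong estimates, the second for exploration stopped by mistake: by
    telescoping, [r k] bounds the sum of [exp(- gam j)] over [j >= k]. *)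
Definition potential k st : R := c * Phi st + r k * Usum st.

Lemma potential_ge0 k st : 0 <= potential k st.
Proof.
rewrite addr_ge0 ?mulr_ge0// sumr_ge0// => a _.
by rewrite mulr_ge0 ?lrsum_ge0// addr_ge0// mulr_ge0// ltW.
Qed.

Let Epot k st b := c * EPhi st b + r k.+1 * Usum st.

Let mean_le_potential k st x b :
  mean_le (F (param C b) x) (fun y => potential k.+1 (update st x b y))
    (Epot k st b).
Proof.
apply: mean_leD; first by apply: (mean_leZ c_ge0); exact: mean_le_Phi.
apply: (mean_leZ (r_ge0 _)).
apply: mean_le_sum => a _; apply: mean_leW; last first.
  apply: (@mean_le_lrsum _ _ _ _ _ _ 1) => v _.
  by under eq_fun do rewrite mul1r; exact: L1.
by case: ifP; rewrite mul1r.
Qed.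

Let r_drop k st : r k.+1 * Usum st + expR (- gam k) * Usum st <= r k * Usum st.
Proof.
by rewrite -mulrDl ler_wpM2r// -lerBrDl.
Qed.

Let Epot_le k st b : Epot k st b <= potential k st.
Proof.
apply: lerD; first exact: ler_wpM2l.
apply: le_trans (r_drop k st).
by rewrite lerDl mulr_ge0// expR_ge0.
Qed.

(** [Psi] only has to pay when both estimates are correct; otherwise [potential] pays, in each of
    the cases of [wrong_estimate_cost]. *)
Lemma value_le_potential (Psi : state -> R) (EPsi : nat -> state -> X -> R) T :
  (forall st, 0 <= Psi st) ->
  (forall k st x, (k < T)%N -> mean_le (F (param C (decide k st x)) x)
     (fun y => Psi (update st x (decide k st x) y)) (EPsi k st x)) ->
  (forall k st x, (k < T)%N -> EPsi k st x <= Psi st) ->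
  (forall k st x, (k < T)%N -> (forall a, est st a = param C a) ->
     inferior_cost F C x (decide k st x) + EPsi k st x <= Psi st) ->
  forall n k st, (n + k <= T)%N ->
    (value n k st <= (potential k st + Psi st)%:E)%E.
Proof.
move=> Psi0 mPsi EPsi_le EPsi_cost.
apply: (@value_le _ _ _ _ _ _ _ _ _ _ (fun k st => potential k st + Psi st)
  (fun k st x => Epot k st (decide k st x) + EPsi k st x)) => //.
- by move=> k st; rewrite addr_ge0// potential_ge0.
- by move=> k st x kT; apply: mean_leD; [exact: mean_le_potential|exact: mPsi].
move=> k st kT.
have sumG (z : R) : \sum_x G x * z = z by rewrite -mulr_suml G1 mul1r.
have pointwise : (forall x, inferior_cost F C x (decide k st x) +
      (Epot k st (decide k st x) + EPsi k st x) <= potential k st + Psi st) ->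
    \sum_x G x * (inferior_cost F C x (decide k st x) +
      (Epot k st (decide k st x) + EPsi k st x)) <= potential k st + Psi st.
  move=> h; rewrite -[leRHS]sumG; apply: ler_sum => x _.
  by rewrite ler_wpM2l.
have [eC|] := pselect (forall a, est st a = param C a).
  apply: pointwise => x; rewrite addrCA lerD//.
  exact: EPsi_cost.
move=> /existsNP[a0 wa0].
have [[x1 [a [wa da]]]|cost0|[a [v [va gv]]]] :=
    wrong_estimate_cost F gam xstar k wa0.
- have V1 : 1 <= V st a.
    apply: (@le_trans _ _ (expR (s * llr st a (est st a)))).
      rewrite -expR0 ler_expR mulr_ge0 ?(ltW s_gt0)// subr_ge0; exact: est_max.
    by apply: lrsum_ge; apply/eqP.
  (* A drop is guaranteed only at [x1]. It is at least [c * eta = 1/g] and [x1] has probability at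
     least [g], so on average it covers a cost of one. *)
  have drop x : inferior_cost F C x (decide k st x) +
      (Epot k st (decide k st x) + EPsi k st x) <=
      1 + potential k st + Psi st - (x == x1)%:R * (c * eta).
    have /andP[_ c1] := inferior_cost_range F C x (decide k st x).
    have := EPsi_le k st x kT; have := Epot_le k st (decide k st x).
    have [xx|_] := eqVneq x x1; last by rewrite mul0r; lra.
    move=> _ e1; rewrite mul1r; rewrite -xx in da.
    have h1 := ler_wpM2l c_ge0 (EPhi_drop da).
    have h2 : c * eta <= c * (eta * V st a).
      by rewrite ler_wpM2l// ler_peMr// ltW.
    have h3 := r_drop k st.
    have h4 : 0 <= expR (- gam k) * Usum st by rewrite mulr_ge0// expR_ge0.
    rewrite /potential /Epot; lra.
  apply: (@le_trans _ _ (\sum_x G x *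
    (1 + potential k st + Psi st - (x == x1)%:R * (c * eta)))).
    by apply: ler_sum => x _; rewrite ler_wpM2l.
  under eq_bigr do rewrite mulrBr.
  rewrite sumrB sumG (bigD1 x1)//= eqxx mul1r big1 ?addr0; last first.
    by move=> x /negPf ->; rewrite mul0r mulr0.
  suff : 1 <= G x1 * (c * eta) by lra.
  rewrite /c invfM -[g^-1 * _ * _]mulrA mulVf ?gt_eqF// mulr1.
  by rewrite ler_pdivlMr// mul1r.
- apply: pointwise => x; rewrite cost0 add0r lerD//; exact: EPsi_le.
(* Some wrong parameter has likelihood ratio at least [exp(gam k)], so the decrease of [r] alone
   covers the cost. *)
- apply: pointwise => x.
  have /andP[_ c1] := inferior_cost_range F C x (decide k st x).
  have := EPsi_le k st x kT.
  have : 1 <= expR (- gam k) * Usum st.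
    rewrite expRN ler_pdivlMl ?expR_gt0// mulr1.
    apply: (@le_trans _ _ (expR (1 * llr st a v))); first by rewrite mul1r ler_expR.
    rewrite /Usum (bigD1 a)//=; apply: (@le_trans _ _ (U st a)).
      by apply: lrsum_ge; apply/eqP.
    by rewrite lerDl sumr_ge0// => *; exact: lrsum_ge0.
  have := r_drop k st.
  have := ler_wpM2l c_ge0 (EPhi_le st (decide k st x)).
  rewrite /potential /Epot; lra.
Qed.

End potential.

(** * The cost of exploration under correct estimates *)

Section exploration.
Variables (R : realType) (Theta X : finType).
Variables (F : Theta -> X -> probability R R).
Variables (L : Theta -> X -> R -> R) (gam : nat -> R).
Variables (xstar : Theta -> Theta -> X) (th0 : Theta).
Variables (C : config Theta) (p : arm).

Local Notation mu := (mean F).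
Local Notation q := (other p).
Local Notation decide := (decide F gam xstar th0).
Local Notation state := (state R Theta X).
Local Notation update := (update L).
Local Notation est := (est th0).
Local Notation xq := (xstar (param C q) (param C p)).
Local Notation Q := (alt F (param C p)).

Hypothesis p_best : forall z, mu (param C q) z < mu (param C p) z.

Variables (s lam gT : R) (n0 T : nat).
Hypothesis s_gt0 : 0 < s.
Hypothesis lam_gt0 : 0 < lam.
Hypothesis lam_lt1 : lam < 1.
Hypothesis gam_le : forall k, (k < T)%N -> gam k <= gT.
Hypothesis Llam : forall v, Q v -> mean_le (F (param C q) xq)
  (fun y => expR (s * (L v xq y - L (param C q) xq y))) lam.
Hypothesis Lle1 : forall v x, mean_le (F (param C q) x)
  (fun y => expR (s * (L v x y - L (param C q) x y))) 1.

Let n (st : state) := npull st q xq.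
Let W (st : state) := lrsum C s Q st q.
Let e := expR (s * gT).

(* Pays one unit for each of the first [n0] explorations; the second summand is
   preserved on average by these and drops by at least one at every later
   exploration. *)
Definition explore_potential (st : state) : R :=
  (n0 - n st)%:R + W st * (e * lam ^+ (n0 - n st) / (1 - lam)).

Definition explore_mean k (st : state) x : R :=
  if (decide k st x == q) && (x == xq) then
    (n0 - (n st).+1)%:R + lam * W st * (e * lam ^+ (n0 - (n st).+1) / (1 - lam))
  else explore_potential st.

Let coef_ge0 m : 0 <= e * lam ^+ m / (1 - lam).
Proof.
by rewrite divr_ge0 ?mulr_ge0 ?expR_ge0 ?exprn_ge0 ?ltW// ?subr_ge0 ?subr_gt0.
Qed.

Lemma explore_potential_ge0 st : 0 <= explore_potential st.
Proof. by rewrite addr_ge0// mulr_ge0// lrsum_ge0. Qed.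

Lemma mean_le_explore k st x : mean_le (F (param C (decide k st x)) x)
  (fun y => explore_potential (update st x (decide k st x) y))
  (explore_mean k st x).
Proof.
rewrite /explore_potential /explore_mean /n /= [q == _]eq_sym [xq == _]eq_sym.
case: ifPn => [/andP[/eqP dq /eqP xE]|not_q].
  apply: mean_leD; first exact: mean_le_cst.
  under eq_fun do rewrite mulrC.
  rewrite [X in mean_le _ _ X]mulrC; apply: mean_leZ => //.
  have := @mean_le_lrsum _ _ X F L C s Q st q q x lam.
  by rewrite eqxx dq xE; apply.
apply: mean_leD; first exact: mean_le_cst.
under eq_fun do rewrite mulrC.
rewrite [X in mean_le _ _ X]mulrC; apply: mean_leZ => //.
have := @mean_le_lrsum _ _ X F L C s Q st q (decide k st x) x 1.
by rewrite if_same mul1r; apply.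
Qed.

(** The contraction of [W] by [lam] exactly offsets the loss of one power of [lam] in its
    coefficient, so only the counter moves. *)
Let drop k st x : (decide k st x == q) && (x == xq) ->
  (n0 <= n st)%N = false ->
  explore_mean k st x + 1 <= explore_potential st.
Proof.
move=> dq /negbT; rewrite -ltnNge => lt; rewrite /explore_mean dq /explore_potential.
rewrite -[(n0 - n st)%N]prednK ?subn_gt0// -subnS exprS -natr1.
by rewrite le_eqVlt; apply/orP; left; apply/eqP; ring.
Qed.

(** Truncated subtraction freezes the counter and the coefficient at this stage, and the divisor
    [1 - lam] turns the contraction into a drop of [W st * e]. *)
Let drop' k st x : (decide k st x == q) && (x == xq) -> (n0 <= n st)%N ->
  explore_mean k st x + W st * e <= explore_potential st.
Proof.
move=> dq le; rewrite /explore_mean dq /explore_potential.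
have -> : (n0 - (n st).+1 = 0)%N by apply/eqP; rewrite subn_eq0 leqW.
have -> : (n0 - n st = 0)%N by apply/eqP; rewrite subn_eq0.
rewrite le_eqVlt; apply/orP; left; apply/eqP; field.
by rewrite subr_eq0 eq_sym lt_eqF.
Qed.

Lemma explore_mean_le k st x : explore_mean k st x <= explore_potential st.
Proof.
have [dq|nq] := boolP ((decide k st x == q) && (x == xq)); last first.
  by rewrite /explore_mean (negPf nq).
have [le|lt] := boolP (n0 <= n st)%N.
  apply: le_trans (drop' dq le).
  by rewrite lerDl mulr_ge0 ?lrsum_ge0 ?expR_ge0.
by apply: le_trans (drop dq (negPf lt)); rewrite lerDl.
Qed.

(** A cost reveals an alternative whose log-likelihood is less than [gT] below the truth, so
    [W st * e] is at least one. *)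
Lemma explore_mean_cost k st x : (k < T)%N ->
  (forall a, est st a = param C a) ->
  inferior_cost F C x (decide k st x) + explore_mean k st x <=
  explore_potential st.
Proof.
move=> kT eC.
have [->|c0] := eqVneq (inferior_cost F C x (decide k st x)) 0.
  by rewrite add0r explore_mean_le.
have /andP[_ c1] := inferior_cost_range F C x (decide k st x).
have [a [v [ba xE da av lt]]] := correct_estimate_cost eC c0.
have ap : a = p.
  apply/eqP; apply: contraT => /neq_other aq.
  move: ba; rewrite aq otherK => ba.
  by have := lt_trans (ba xq) (p_best xq); rewrite ltxx.
move: ba xE da av lt; rewrite ap => _ xE da av lt.
have dq : (decide k st x == q) && (x == xq) by rewrite da xE !eqxx.
have [le|nlt] := boolP (n0 <= n st)%N; last first.
  by have := drop dq (negPf nlt); lra.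
have h := drop' dq le.
suff : 1 <= W st * e by lra.
rewrite /e -ler_pdivrMr ?expR_gt0// mul1r -expRN.
apply: (@le_trans _ _ (expR (s * llr C st q v))); last exact: lrsum_ge.
rewrite ler_expR -mulrN ler_pM2l// /llr.
have := gam_le kT; lra.
Qed.

Lemma explore_potential0 : expR (s * gT) * lam ^+ n0 <= 1 ->
  explore_potential (state0 R Theta X) <= n0%:R + #|Theta|%:R / (1 - lam).
Proof.
move=> h; rewrite /explore_potential /n /= subn0 lerD2l mulrA.
rewrite ler_wpM2r ?invr_ge0 ?subr_ge0 ?(ltW lam_lt1)//.
rewrite -[leRHS]mulr1 ler_pM ?lrsum_ge0//.
  by rewrite mulr_ge0 ?expR_ge0// exprn_ge0// ltW.
rewrite /W /lrsum (eq_bigr (fun=> 1)); last first.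
  by move=> v _; rewrite /llr /= subrr mulr0 expR0.
by rewrite sumr_const ler_nat max_card.
Qed.

End exploration.

(** * The exploration threshold *)

Section threshold.
Variable R : realType.

Definition threshold (t : nat) : R := ln t.+3%:R + 2 * ln (ln t.+3%:R).
Definition threshold_tail (t : nat) : R := (ln t.+2%:R)^-1.

Lemma ln_natS2_gt0 t : 0 < ln t.+2%:R :> R.
Proof. by rewrite ln_gt0// ltr1n. Qed.

Lemma threshold_tail_ge0 t : 0 <= threshold_tail t.
Proof. by rewrite invr_ge0 ltW// ln_natS2_gt0. Qed.

(** The discrete form of the fact that [1 / (x (ln x)^2)] is minus the derivative of [1 / ln x]:
    here [b - a >= 1/(t+3)] and [a * b <= b^2]. *)
Lemma threshold_tailP t :
  expR (- threshold t) <= threshold_tail t - threshold_tail t.+1.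
Proof.
rewrite /threshold /threshold_tail.
set a := ln t.+2%:R; set b := ln t.+3%:R.
have a0 : 0 < a by exact: ln_natS2_gt0.
have b0 : 0 < b by exact: ln_natS2_gt0.
have t0 : 0 < t.+3%:R :> R by rewrite ltr0n.
have ab : t.+3%:R^-1 <= b - a.
  rewrite -lerN2 opprB /a /b -ln_div ?posrE ?ltr0n//.
  have -> : t.+2%:R / t.+3%:R = 1 + - t.+3%:R^-1 :> R.
    apply: (mulIf (lt0r_neq0 t0)); rewrite divfK ?gt_eqF// mulrDl mul1r mulNr.
    by rewrite mulVf ?gt_eqF// -[t.+3%:R]natr1 addrK.
  by rewrite le_ln1Dx// ltrN2 invf_lt1// ltr1n.
have le_ab : a <= b.
  by rewrite -subr_ge0; apply: le_trans ab; rewrite invr_ge0 ltW.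
have -> : expR (- (b + 2 * ln b)) = t.+3%:R^-1 / (b * b).
  rewrite expRN expRD lnK ?posrE// [2 * _]mulr_natl mulr2n expRD lnK ?posrE//.
  by rewrite invfM.
have -> : a^-1 - b^-1 = (b - a) / (a * b).
  by field; rewrite (lt0r_neq0 a0) (lt0r_neq0 b0).
apply: ler_pM => //.
- by rewrite invr_ge0 mulr_ge0// ltW.
- by rewrite lef_pV2 ?posrE ?mulr_gt0// ler_pM2r.
Qed.

Lemma threshold_le k t : (k <= t)%N -> threshold k <= threshold t.
Proof.
move=> kt; have h : ln k.+3%:R <= ln t.+3%:R :> R.
  by rewrite ler_ln ?posrE ?ltr0n// ler_nat !ltnS.
rewrite lerD// ler_pM2l// ler_ln// ?posrE ?ln_natS2_gt0//.
Qed.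

Lemma threshold_growth (eps : R) : 0 < eps -> exists2 c, 0 <= c &
  forall t, (0 < t)%N -> threshold t <= (1 + eps) * ln t%:R + c.
Proof.
move=> e0; pose c : R := (1 + eps) * ln 4%:R - 2 * ln (eps / 2).
exists `|c| => // t t0; apply: (@le_trans _ _ ((1 + eps) * ln t%:R + c)); last first.
  by rewrite lerD2l ler_norm.
have b0 := ln_natS2_gt0 t.+1.
have e2 : 0 < eps / 2 by rewrite divr_gt0.
(* Rescaling by [eps / 2] gives [2 ln b <= eps b - 2 ln (eps / 2)], which absorbs the iterated
   logarithm. *)
have h1 := ln_sublinear (mulr_gt0 e2 b0).
rewrite lnM ?posrE// in h1.
have h2 : ln t.+3%:R <= ln t%:R + ln 4%:R :> R.
  rewrite -lnM ?posrE ?ltr0n// -natrM ler_ln ?posrE ?ltr0n ?muln_gt0 ?t0//.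
  rewrite ler_nat; case: t t0 {b0 h1} => // t _.
  lia.
rewrite /threshold /c; nra.
Qed.

Lemma limn_esup_div_ln (u : nat -> \bar R) (A B : R) :
  (forall t, (0 < t)%N -> (u t <= (A + B * ln t%:R)%:E)%E) ->
  (limn_esup (fun t => u t * ((ln t%:R)^-1)%:E) <= B%:E)%E.
Proof.
move=> h; apply/lee_addgt0Pr => e e0.
(* From [N] on, [ln t] is positive and at least [|A| / e], so [A / ln t <= e]. *)
pose N := (Num.truncn (expR (`|A| / e))).+2.
apply: (@le_trans _ _ (ereal_sup ((fun t => u t * ((ln t%:R)^-1)%:E)%E @`
    [set t | (N <= t)%N]))).
  apply: ereal_inf_lbound; exists [set t | (N <= t)%N] => //.
  by exists N.
apply: ge_ereal_sup => _ [t /= Nt <-].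
have t1 : (1 < t)%N by apply: leq_trans Nt.
have lt0 : 0 < ln t%:R :> R by rewrite ln_gt0// ltr1n.
apply: (@le_trans _ _ ((A + B * ln t%:R)%:E * ((ln t%:R)^-1)%:E)%E).
  by rewrite lee_wpmul2r ?lee_fin ?invr_ge0 ?(ltW lt0)// h// ltnW.
rewrite -EFinM -EFinD lee_fin mulrDl mulfK ?gt_eqF// addrC lerD2l.
rewrite ler_pdivrMr// (le_trans (ler_norm A))// -ler_pdivrMl//.
rewrite mulrC -ler_expR lnK ?posrE ?ltr0n 1?ltnW//.
apply: (le_trans (ltW (truncnS_gt _))).
by rewrite ler_nat ltnW.
Qed.

End threshold.

Lemma finite_pos_lower_bound (R : realType) (I : finType) (f : I -> R) :
  (forall i, 0 < f i) -> exists2 m, 0 < m <= 1 & forall i, m <= f i.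
Proof.
move=> f0; suff [m m01 mf] : exists2 m, 0 < m <= 1 & forall i, i \in enum I -> m <= f i.
  by exists m => // i; apply: mf; rewrite mem_enum.
elim: (enum I) => [|j r [m /andP[m0 m1] mf]]; first by exists 1 => //; rewrite ltr01 lexx.
exists (Num.min m (f j)).
  by rewrite lt_min m0 f0 ge_min m1.
move=> i; rewrite inE => /orP[/eqP ->|/mf h]; first by rewrite ge_min lexx orbT.
by rewrite ge_min h.
Qed.

(** * Bounds for the bandit *)

(** The number of explorations is threshold growth over contraction rate; each is off by a relative
    error [eta]. *)
Lemma rate_slack (R : realType) (k e eta : R) : 0 < k -> 0 < e ->
  0 < eta -> eta <= 1 / 2 -> eta <= e * k / 4 ->
  (1 + eta) / (k - k * eta) <= k^-1 + e.
Proof.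
move=> k0 e0 eta0 eta1 eta2.
rewrite ler_pdivrMr; last by nra.
rewrite mulrDl mulrBr mulVf ?gt_eqF// mulrA mulVf ?gt_eqF// mul1r.
by have := ler_wpM2r (_ : 0 <= 1 - eta) eta2; nra.
Qed.

Section bandit_bounds.
Variables (R : realType) (Theta X : finType).
Variables (G : X -> R) (F : Theta -> X -> probability R R) (th0 : Theta).
Hypothesis G_gt0 : forall x, 0 < G x.
Hypothesis G1 : \sum_x G x = 1.
Hypothesis KLF : forall th v x, th <> v ->
  (0 < KL F th v x)%E /\ (KL F th v x < +oo)%E.
Variable xstar : Theta -> Theta -> X.
Hypothesis xstarP : forall th th' v, alt F th' v ->
  (K_supinf F th th' <= KL F th v (xstar th th'))%E.

Definition bandit_loglik th x := loglik (fun v => F v x) th0 th.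
Local Notation L := bandit_loglik.
Let kl th v x : R := fine (KL F th v x).

Let KLE th v x : th <> v -> KL F th v x = (kl th v x)%:E.
Proof.
move=> ne; have [h1 h2] := KLF x ne; rewrite fineK//.
by rewrite ge0_fin_numE// ltW.
Qed.

Let kl_gt0 th v x : th <> v -> 0 < kl th v x.
Proof. by move=> ne; have [+ _] := KLF x ne; rewrite KLE. Qed.

Let L1 th v x : mean_le (F th x) (fun y => expR (L v x y - L th x y)) 1.
Proof. by apply: mean_le_loglik => i j; exact: KLF. Qed.

Let mL th x : measurable_fun setT (L th x).
Proof. by apply: measurable_loglik => i j; exact: KLF. Qed.

Let L_frac s th v x : 0 <= s <= 1 ->
  mean_le (F th x) (fun y => expR (s * (L v x y - L th x y))) 1.
Proof.
move=> s01; rewrite (_ : (fun _ => _) =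
    (fun y => expR (- (s * (L th x y - L v x y))))); last first.
  by apply/funext => y; rewrite -mulrN opprB.
apply: mean_le_expR_frac => //; first exact: measurable_funB.
by under eq_fun do rewrite opprB; exact: L1.
Qed.

(** Each triple has its own bound [s0]; finiteness allows one [s] below all of them. *)
Let L_rate delta : 0 < delta -> exists2 s, 0 < s <= 1 &
  forall th v x, v != th ->
    mean_le (F th x) (fun y => expR (s * (L v x y - L th x y)))
      (1 - s * (kl th v x - delta)).
Proof.
move=> d0.
have /choice[f fP] : forall i : Theta * Theta * X, exists s0 : R, 0 < s0 /\
    forall s, 0 < s <= s0 -> i.1.2 != i.1.1 ->
    mean_le (F i.1.1 i.2) (fun y => expR (s * (L i.1.2 i.2 y - L i.1.1 i.2 y)))
      (1 - s * (kl i.1.1 i.1.2 i.2 - delta)).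
  move=> [[th v] x] /=; have [->|/eqP ne] := eqVneq v th.
    by exists 1; split.
  have [iZ EZ] := @loglik_KLdiv R _ (fun v => F v x) th0
    (fun i j => @KLF i j x) th v (nesym ne).
  have [||||s0 /andP[s00 _] hs] := @mean_le_expR_rate R _ _ (F th x)
    (fun y => L th x y - L v x y) (kl th v x) _ _ _ _ delta d0.
  - exact: measurable_funB.
  - exact: iZ.
  - by rewrite -KLE//; exact: nesym.
  - by under eq_fun do rewrite opprB; exact: L1.
  exists s0; split => // s s1 _; rewrite (_ : (fun _ => _) =
    (fun y => expR (- (s * (L th x y - L v x y))))); first exact: hs.
  by apply/funext => y; rewrite -mulrN opprB.
have [s /andP[s0 s1] sf] := finite_pos_lower_bound (fun i => (fP i).1).
exists s; first by rewrite s0.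
by move=> th v x ne; apply: (fP (th, v, x)).2 => //; rewrite s0/= sf.
Qed.

Let kl_lower : exists2 k0, 0 < k0 <= 1 &
  forall th v x, th <> v -> k0 <= kl th v x.
Proof.
have [|k0 k01 h] := @finite_pos_lower_bound R (Theta * Theta * X)%type
  (fun i => if i.1.1 == i.1.2 then 1 else kl i.1.1 i.1.2 i.2).
  by move=> [[th v] x] /=; case: eqP => // ne; exact: kl_gt0.
exists k0 => // th v x ne; have := h (th, v, x) => /=.
by case: eqP.
Qed.

Definition bandit_rule := rule F L (threshold R) xstar th0.
Local Notation phi := bandit_rule.

Lemma measurable_bandit_rule : measurable_rule phi.
Proof. exact: measurable_rule_rule. Qed.

Let expected_TinfE C t : expected_Tinf F G phi C t =
  value F G L (threshold R) xstar th0 C t 0 (state0 R Theta X).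
Proof. by rewrite /expected_Tinf cost_to_goE. Qed.

Section fixed_rate.
Variables (s delta k0 : R).
Hypothesis s01 : 0 < s <= 1.
Hypothesis k0_gt0 : 0 < k0.
Hypothesis delta_le : delta <= k0 / 2.
Hypothesis k0P : forall th v x, th <> v -> k0 <= kl th v x.
Hypothesis sP : forall th v x, v != th ->
    mean_le (F th x) (fun y => expR (s * (L v x y - L th x y)))
      (1 - s * (kl th v x - delta)).

Let rho := 1 - s * (k0 / 2).

Let rho_lt1 : rho < 1.
Proof.
by case/andP: s01 => s0 _; rewrite /rho ltrBlDr ltrDl mulr_gt0// divr_gt0.
Qed.

Lemma value_le_fixed_rate C : exists A : R,
  forall (T : nat) (Psi : state R Theta X -> R) EPsi,
  (forall st, 0 <= Psi st) ->
  (forall k st x, (k < T)%N ->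
     mean_le (F (param C (decide F (threshold R) xstar th0 k st x)) x)
     (fun y => Psi (update L st x (decide F (threshold R) xstar th0 k st x) y))
     (EPsi k st x)) ->
  (forall k st x, (k < T)%N -> EPsi k st x <= Psi st) ->
  (forall k st x, (k < T)%N -> (forall a, est th0 st a = param C a) ->
     inferior_cost F C x (decide F (threshold R) xstar th0 k st x) + EPsi k st x
       <= Psi st) ->
  (expected_Tinf F G phi C T <= (A + Psi (state0 R Theta X))%:E)%E.
Proof.
have [g /andP[g0 _] gG] := finite_pos_lower_bound G_gt0.
(* The witness is the potential of the initial state, which depends neither on [T] nor on [Psi]. *)
eexists => T Psi EPsi h1 h2 h3 h4; rewrite expected_TinfE.
apply: (@value_le_potential _ _ _ F G L (threshold R) xstar th0 C s rho g
  (@threshold_tail R) _ rho_lt1 g0 gG G1 (@threshold_tail_ge0 R)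
  (@threshold_tailP R) L1 _ Psi EPsi T h1 h2 h3 h4).
- by case/andP: s01.
- move=> th v x ne; apply: mean_leW (sP x ne).
  have := k0P x (nesym (elimN eqP ne)); case/andP: s01 => s0 _; rewrite /rho => h.
  rewrite lerD2l lerN2 ler_pM2l//.
  by move: h (delta_le); move: (kl th v x) => z; lra.
- by rewrite addn0.
Qed.

End fixed_rate.

(** Neither arm is strictly better everywhere, so correct estimates cost nothing and [Psi = 0]
    suffices. The expected cost is then bounded, and it is monotone in the horizon. *)
Lemma revealing_bounded C : implicitly_revealing F C ->
  exists l : R, expected_Tinf F G phi C @ \oo --> l%:E.
Proof.
move=> [[x1 p1] [x2 p2]].
have [k0 /andP[k00 _] k0P] := kl_lower.
have [s s01 sP] := L_rate (divr_gt0 k00 (ltr0Sn R 1)).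
have [A hA] := value_le_fixed_rate s01 k00 (lexx _) k0P sP C.
have uA t : (expected_Tinf F G phi C t <= A%:E)%E.
  rewrite -[A]addr0; apply: (hA t (fun=> 0) (fun _ _ _ => 0)) => //.
    by move=> k st x _; exact: mean_le_cst.
  move=> k st x _ eC; rewrite addr0.
  have [->//|/(correct_estimate_cost eC)[a [v [ba _ _ _ _]]]] :=
    eqVneq (inferior_cost F C x (decide F (threshold R) xstar th0 k st x)) 0.
  case: a ba => ba.
    by have := lt_le_trans (ba x2) p2; rewrite ltxx.
  by have := lt_le_trans (ba x1) p1; rewrite ltxx.
have G0 x : 0 <= G x by exact: ltW.
have nd : {homo expected_Tinf F G phi C : m n / (m <= n)%N >-> (m <= n)%E}.
  apply/nondecreasing_seqP => t; rewrite !expected_TinfE.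
  exact: value_nondecreasing.
have := ereal_nondecreasing_cvgn nd.
set l := ereal_sup _ => cl.
have l1 : (l <= A%:E)%E by apply: ge_ereal_sup => _ [t _ <-].
have l0 : (0 <= l)%E.
  apply: le_ereal_sup_tmp; exists (expected_Tinf F G phi C 0%N) => //.
exists (fine l); rewrite fineK// ge0_fin_numE//.
exact: le_lt_trans l1 (ltry _).
Qed.

Lemma nonrevealing_limsup C p :
  (forall x, mean F (param C (other p)) x < mean F (param C p) x) ->
  K_infsup F (param C (other p)) (param C p) =
    K_supinf F (param C (other p)) (param C p) ->
  (limn_esup (fun t => expected_Tinf F G phi C t * ((ln t%:R)^-1)%:E)
   <= einv (K_infsup F (param C (other p)) (param C p)))%E.
Proof.
move=> pb saddle.
set thq := param C (other p); set thp := param C p.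
have [k0 /andP[k00 _] k0P] := kl_lower.
have altN v : alt F thp v -> thq <> v.
  by move=> /existsP[z lt] e; have := pb z; rewrite -/thq e ltNge ltW.
(* Without alternatives the infimum is over the empty set and correct estimates cost nothing; that
   case is treated last. *)
have [none|/negPn/existsP[v0 av0]] := boolP (~~ [exists v, alt F thp v]); last first.
  set K := K_infsup F thq thp.
  (* This is where the saddle point enters: one side observation discriminates against all
     alternatives at rate [K]. *)
  have Kle v : alt F thp v -> (K <= KL F thq v (xstar thq thp))%E.
    by move=> av; rewrite /K [leLHS]saddle; exact: xstarP.
  have Kge : (k0%:E <= K)%E.
    apply: le_ereal_inf_tmp => _ [v /= [z lt] <-].
    have av : alt F thp v by apply/existsP; exists z.
    apply: (@le_trans _ _ (KL F thq v z)).
      by rewrite KLE ?lee_fin ?k0P//; exact: altN.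
    by apply: ereal_sup_ubound; exists z.
  have Koo : (K < +oo)%E.
    by apply: le_lt_trans (Kle _ av0) _; have [] := KLF (xstar thq thp) (altN _ av0).
  have Kfin : K \is a fin_num.
    by rewrite ge0_fin_numE//; apply: le_trans Kge; rewrite lee_fin ltW.
  move: Kle Kge; rewrite -(fineK Kfin); move: (fine K) => kap Kle.
  rewrite lee_fin => k0kap /=.
  have kap0 : 0 < kap by exact: lt_le_trans k00 k0kap.
  apply/lee_addgt0Pr => e e0; rewrite -EFinD.
  (* The first two bounds are for [rate_slack]; the third makes [delta = kap * eta] at most
     [k0 / 2]. *)
  pose eta := Num.min (1 / 2) (Num.min (e * kap / 4) (k0 / 2 / kap)).
  have eta0 : 0 < eta by rewrite !lt_min !divr_gt0// mulr_gt0.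
  have eta1 : eta <= 1 / 2 by rewrite ge_min lexx.
  have eta2 : eta <= e * kap / 4 by rewrite !ge_min lexx orbT.
  have eta3 : kap * eta <= k0 / 2.
    by rewrite mulrC -ler_pdivlMr// !ge_min lexx !orbT.
  have [s s01 sP] := L_rate (mulr_gt0 kap0 eta0).
  have [s0 s1] := andP s01.
  have [A hA] := value_le_fixed_rate s01 k00 eta3 k0P sP C.
  pose rate := kap - kap * eta.
  have rate0 : 0 < rate by rewrite /rate; nra.
  (* The exponential dominates the factor [1 - s * rate] and makes powers of [lam] comparable with
     [exp(s * gT)]. *)
  pose lam := expR (- (s * rate)).
  have lam0 : 0 < lam by exact: expR_gt0.
  have lam1 : lam < 1 by rewrite expR_lt1 oppr_lt0 mulr_gt0.
  have [c c0 growth] := threshold_growth eta0.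
  apply: (@limn_esup_div_ln _ _ (A + (c / rate + 1 + #|Theta|%:R / (1 - lam)))).
  move=> t t0; pose gT := (1 + eta) * ln t%:R + c.
  have lt0 : 0 <= ln t%:R :> R by rewrite ln_ge0// ler1n.
  have gT0 : 0 <= gT by rewrite addr_ge0// mulr_ge0// addr_ge0// ltW.
  (* Enough explorations for [n0 * rate] to exceed [gT], so that [exp(s * gT) * lam ^+ n0 <= 1]. *)
  pose n0 := (Num.truncn (gT / rate)).+1.
  have /andP[n0_le n0_gt] := truncn_itv (divr_ge0 gT0 (ltW rate0)).
  have gam_le k : (k < t)%N -> threshold R k <= gT.
    by move=> kt; apply: le_trans (growth t t0); exact/threshold_le/ltnW.
  have Llam v : alt F thp v -> mean_le (F thq (xstar thq thp))
      (fun y => expR (s * (L v (xstar thq thp) y - L thq (xstar thq thp) y))) lam.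
    move=> av; have ne : v != thq by apply/eqP => e1; exact: (altN _ av).
    apply: mean_leW (sP thq v (xstar thq thp) ne).
    apply: le_trans (expR_ge1Dx _); rewrite lerD2l lerN2 ler_pM2l// lerB//.
    by have := Kle _ av; rewrite KLE ?lee_fin//; exact: altN.
  have s01' : 0 <= s <= 1 by rewrite (ltW s0).
  apply: (le_trans (hA t (explore_potential F xstar C p s lam gT n0)
    (explore_mean F (threshold R) xstar th0 C p s lam gT n0) _ _ _ _)).
  - by move=> st; exact: explore_potential_ge0.
  - move=> k st x _; apply: mean_le_explore => // v x'; exact: L_frac.
  - by move=> k st x _; apply: explore_mean_le.
  - by move=> k st x kt eC; apply: (explore_mean_cost xstar pb n0 s0 lam1 gam_le x kt eC).
  have h1 : expR (s * gT) * lam ^+ n0 <= 1.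
    rewrite /lam -expRM_natl -expRD expR_le1 mulrN mulrCA -mulrBr.
    rewrite pmulr_rle0// subr_le0 -ler_pdivrMr// ltW//.
  have h2 := explore_potential0 F xstar C p lam0 lam1 h1.
  rewrite lee_fin.
  have h3 : n0%:R <= gT / rate + 1 by rewrite -natr1 lerD2r.
  have h4 : gT / rate <= (kap^-1 + e) * ln t%:R + c / rate.
    rewrite /gT mulrDl lerD2r mulrAC ler_wpM2r//.
    exact: rate_slack.
  rewrite -addrA lerD2l; apply: (le_trans h2).
  have h34 := le_trans h3 (lerD h4 (lexx 1)).
  apply: (le_trans (lerD h34 (lexx (#|Theta|%:R / (1 - lam))))).
  by rewrite le_eqVlt; apply/orP; left; apply/eqP; ring.
have -> : K_infsup F thq thp = +oo%E.
  rewrite /K_infsup (_ : [set vth | _] = set0) ?image_set0 ?ereal_inf0//.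
  apply/seteqP; split => // v /= [x0 lt].
  by move/existsPn : none => /(_ v) /existsPn /(_ x0); rewrite lt.
have [s s01 sP] := L_rate (divr_gt0 k00 (ltr0Sn R 1)).
have [A hA] := value_le_fixed_rate s01 k00 (lexx _) k0P sP C.
apply: (@limn_esup_div_ln _ _ A) => t _; rewrite mul0r.
apply: (hA t (fun=> 0) (fun _ _ _ => 0)) => //.
  by move=> k st x _; exact: mean_le_cst.
move=> k st x _ eC; rewrite addr0.
have [->//|/(correct_estimate_cost eC)[a [v [ba _ _ av _]]]] :=
  eqVneq (inferior_cost F C x (decide F (threshold R) xstar th0 k st x)) 0.
have [ap|/neq_other aq] := eqVneq a p.
  by move/existsPn : none => /(_ v); rewrite /thp -ap av.
move: ba; rewrite aq otherK => ba.
by have := lt_trans (ba x) (pb x); rewrite ltxx.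
Qed.

End bandit_bounds.

Theorem theorem8 (R : realType) (Theta X : finType)
  (G : X -> R) (F : Theta -> X -> probability R R) :
  (* G is a law on the finite set X charging every point: (a), (b) *)
  (forall x, 0 < G x) -> \sum_(x : X) G x = 1 ->
  (* the means mu_theta(x) are finite *)
  (forall th x, (F th x).-integrable [set: R] (fun y => y%:E)) ->
  (* (c) *)
  (forall th vth x, th <> vth ->
     (0 < KL F th vth x)%E /\ (KL F th vth x < +oo)%E) ->
  (* (e) saddle point, arm 2 preferred for every x *)
  (forall th1 th2 : Theta,
     ~ implicitly_revealing F (th1, th2) ->
     (forall x, preferred F (th1, th2) x arm2) ->
     K_infsup F th1 th2 = K_supinf F th1 th2) ->
  (* (e) symmetric case, arm 1 preferred for every x *)
  (forall th1 th2 : Theta,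
     ~ implicitly_revealing F (th1, th2) ->
     (forall x, preferred F (th1, th2) x arm1) ->
     K_infsup F th2 th1 = K_supinf F th2 th1) ->
  exists phi : alloc_rule R X,
    measurable_rule phi /\
    (* (1) *)
    (forall C : config Theta, implicitly_revealing F C ->
       exists l : R, expected_Tinf F G phi C @ \oo --> l%:E) /\
    (* (2), arm 2 preferred for every x *)
    (forall th1 th2 : Theta, th1 <> th2 ->
       ~ implicitly_revealing F (th1, th2) ->
       (forall x, preferred F (th1, th2) x arm2) ->
       (limn_esup (fun t => expected_Tinf F G phi (th1, th2) t
                            * ((ln t%:R)^-1)%:E)
        <= einv (K_infsup F th1 th2))%E) /\
    (* (2), arm 1 preferred for every x *)
    (forall th1 th2 : Theta, th1 <> th2 ->
       ~ implicitly_revealing F (th1, th2) ->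
       (forall x, preferred F (th1, th2) x arm1) ->
       (limn_esup (fun t => expected_Tinf F G phi (th1, th2) t
                            * ((ln t%:R)^-1)%:E)
        <= einv (K_infsup F th2 th1))%E).
Proof.
move=> G0 G1 _ KLF saddle2 saddle1.
have [th0 _|none] := pickP (predT : pred Theta); last first.
  exists (fun _ _ _ => arm1); split.
    move=> t xs; rewrite (_ : [set _ | _] = setT); first exact: measurableT.
    by apply/seteqP; split.
  by split; [case=> th|split => th]; have := none th.
have [x0 _] : exists x0 : X, True.
  have [x0 _|noX] := pickP (predT : pred X); first by exists x0.
  by move: G1; rewrite big_pred0// => /eqP; rewrite eq_sym oner_eq0.
have /choice[xs xsP] : forall i : Theta * Theta, exists x, forall v,
    alt F i.2 v -> (K_supinf F i.1 i.2 <= KL F i.1 v x)%E.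
  move=> [th th'] /=.
  pose f x := ereal_inf [set KL F th v x
    | v in [set v | exists z, mean F th' z < mean F v z]].
  (* As [X] is finite, the outer supremum of [K_supinf] is attained; a maximizer serves as
     exploration point. *)
  have [x _ xmax] := arg_maxP f (erefl : predT x0).
  exists x => v /existsP av; apply: (@le_trans _ _ (f x)).
    by apply: ge_ereal_sup => _ [z _ <-]; exact: xmax.
  by apply: ereal_inf_lbound; exists v.
pose xstar th th' := xs (th, th').
have xstarP th th' v : alt F th' v ->
    (K_supinf F th th' <= KL F th v (xstar th th'))%E by exact: (xsP (th, th')).
(* [preferred] is a weak inequality, so a tie at one point would make the configuration implicitly
   revealing. *)
have strict C p : ~ implicitly_revealing F C -> (forall x, preferred F C x p) ->
    forall x, mean F (param C (other p)) x < mean F (param C p) x.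
  move=> nrev pp x; rewrite ltNge; apply/negP => le; apply: nrev.
  by case: p pp le => pp le; split; exists x => //; exact: pp.
exists (bandit_rule F th0 xstar); split; first exact: measurable_bandit_rule.
split; first by move=> C; exact: revealing_bounded.
split=> th1 th2 _ nrev pp.
- apply: (@nonrevealing_limsup _ _ _ _ _ _ _ _ _ _ _ (th1, th2) arm2) => //=.
    exact: (strict (th1, th2) arm2).
  exact: saddle2.
- apply: (@nonrevealing_limsup _ _ _ _ _ _ _ _ _ _ _ (th1, th2) arm1) => //=.
    exact: (strict (th1, th2) arm1).
  exact: saddle1.
Qed.
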